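(* For every integer $d\ge 4$ and every $\mathbf{x}_0\in\mathbb{R}^d$, $$\left\lfloor\left(\tfrac72\right)^{(d-2)/2}\right\rfloor\le\mathcal{T}_{\rm det}\left(d,1,1,\tfrac12,\tfrac18;\mathbf{x}_0\right)\le 1+33^{d+1}.$$ Consequently, the complexity at these fixed accuracy parameters is $\exp(\Theta(d))$, i.e. it admits upper and lower exponential bounds in $d$ with positive exponent constants independent of $d$ (and of $\mathbf{x}_0$). Moreover, there is no uniform deterministic bound that is a joint polynomial in $(d,\delta^{-1},\epsilon^{-1})$ for the full function class, even with $L=\Delta=1$: there is no polynomial $p$ in three variables such that $\mathcal{T}_{\rm det}(d,1,1,\delta,\epsilon;\mathbf{x}_0)\le p(d,\delta^{-1},\epsilon^{-1})$ for all $d\ge1$, $\delta,\epsilon>0$ and $\mathbf{x}_0\in\mathbb{R}^d$.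
   Context: All norms are Euclidean; $\mathbb{B}_r(\mathbf{x})$ is the closed ball of radius $r$ about $\mathbf{x}$. Goldstein stationarity. For locally Lipschitz $f:\mathbb{R}^d\to\mathbb{R}$, $f^\circ(\mathbf{x};\mathbf{v})=\limsup_{\mathbf{y}\to\mathbf{x},\,t\downarrow 0}\frac{f(\mathbf{y}+t\mathbf{v})-f(\mathbf{y})}{t}$, the Clarke subdifferential is $\partial f(\mathbf{x})=\{\mathbf{g}:\langle\mathbf{g},\mathbf{v}\rangle\le f^\circ(\mathbf{x};\mathbf{v})\ \forall\mathbf{v}\in\mathbb{R}^d\}$, and the Goldstein subdifferential is $\partial_\delta f(\mathbf{x})=\mathrm{conv}\big(\bigcup_{\mathbf{y}\in\mathbb{B}_\delta(\mathbf{x})}\partial f(\mathbf{y})\big)$. A point $\mathbf{x}$ is $(\delta,\epsilon)$-Goldstein stationary if $\inf_{\mathbf{g}\in\partial_\delta f(\mathbf{x})}\|\mathbf{g}\|\le\epsilon$. Function class. $\mathcal{F}_d(L,\Delta;\mathbf{x}_0)$ is the set of all $f:\mathbb{R}^d\to\mathbb{R}$ with $|f(\mathbf{x})-f(\mathbf{y})|\le L\|\mathbf{x}-\mathbf{y}\|$ for all $\mathbf{x},\mathbf{y}$, $\inf f>-\infty$, and $f(\mathbf{x}_0)-\inf f\le\Delta$. Local-oracle model. The algorithm receives $d,L,\Delta,\mathbf{x}_0,\delta,\epsilon$. Its first oracle call is at $\mathbf{x}_0$. An admissible oracle response to a query at $\mathbf{q}$ is any locally Lipschitz function $h_{\mathbf{q}}:\mathbb{R}^d\to\mathbb{R}$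 such that $h_{\mathbf{q}}=f$ on $\mathbb{B}_{\nu}(\mathbf{q})$ for some $\nu=\nu_{\mathbf{q}}>0$; the radius is not revealed. A deterministic algorithm's internal computation, next query, stopping decision and output depend only on the input and on the local information in the previous responses, i.e. on the sequence of previous query points and the germs at these points of the returned functions: replacing any finite collection of responses by functions agreeing with them near the corresponding query points does not change the subsequent behavior before a new response is received. Thus, after each finite history, the algorithm either queries a new point of $\mathbb{R}^d$, returns a point of $\mathbb{R}^d$, or computes forever without any further query or return. Query locations are unrestricted, repeated queries are allowed, and the output need not have been queried. Arbitrary finite internal computation with exact real arithmetic and comparisons is allowed between calls. Every oracle call is counted, including the initial one and repeated ones. Query count and complexity. If the execution of $A$ on $f$ returns, in finite time, a $(\delta,\epsilon)$-Goldstein stationary point of $f$, then $\tau_A(f;\mathbf{x}_0,\delta,\epsilon)$ is its total number of oracle calls; otherwise $\tau_A(f;\mathbf{x}_0,\delta,\epsilon)=+\infty$. The optimal worst-case query complexity is $$\mathcal{T}_{\rm det}(d,L,\Delta,\delta,\epsilon;\mathbf{x}_0)=\inf_A\ \sup_{f\in\mathcal{F}_d(L,\Delta;\mathbf{x}_0)}\tau_A(f;\mathbf{x}_0,\delta,\epsilon),$$ the infimum being over deterministic algorithms in this model. *)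

(* Defs.v *)
From Stdlib Require List.
From HB Require Import structures.
From mathcomp Require Import all_boot all_order all_algebra.
From mathcomp Require Import all_classical all_reals all_analysis.

Set Implicit Arguments.
Unset Strict Implicit.
Unset Printing Implicit Defensive.

Import Order.TTheory GRing.Theory Num.Theory.
Import numFieldNormedType.Exports.

Local Open Scope classical_set_scope.
Local Open Scope ring_scope.

Definition edot (R : realType) (d : nat) (u v : 'rV[R]_d) : R :=
  \sum_(i < d) u 0 i * v 0 i.

(* The library norm on ['rV[R]_d] is the sup norm, whence this definition. *)
Definition enorm (R : realType) (d : nat) (u : 'rV[R]_d) : R :=
  Num.sqrt (edot u u).

Definition ecball (R : realType) (d : nat) (x : 'rV[R]_d) (r : R)
    : set 'rV[R]_d :=
  [set y | enorm (y - x) <= r].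

Definition elipschitz_on (R : realType) (d : nat) (L : R) (A : set 'rV[R]_d)
    (f : 'rV[R]_d -> R) : Prop :=
  forall x y, A x -> A y -> `|f x - f y| <= L * enorm (x - y).

Definition locally_lipschitz (R : realType) (d : nat) (f : 'rV[R]_d -> R)
    : Prop :=
  forall x, exists r L : R, 0 < r /\ elipschitz_on L (ecball x r) f.

(* The limit superior is taken in [\bar R]; the topology used by [nbhs] is the
   product topology, that is, the Euclidean one. *)
Definition clarke_derivative (R : realType) (d : nat) (f : 'rV[R]_d -> R)
    (x v : 'rV[R]_d) : \bar R :=
  limf_esup
    (fun p : 'rV[R]_d * R => ((f (p.1 + p.2 *: v) - f p.1) / p.2)%:E)
    (filter_prod (nbhs x) (0 : R)^'+).

Definition clarke_subdifferential (R : realType) (d : nat)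
    (f : 'rV[R]_d -> R) (x : 'rV[R]_d) : set 'rV[R]_d :=
  [set g | forall v, ((edot g v)%:E <= clarke_derivative f x v)%E].

Definition convex_hull (R : realType) (d : nat) (A : set 'rV[R]_d)
    : set 'rV[R]_d :=
  smallest (@convex_set R 'rV[R]_d) A.

Definition goldstein_subdifferential (R : realType) (d : nat) (delta : R)
    (f : 'rV[R]_d -> R) (x : 'rV[R]_d) : set 'rV[R]_d :=
  convex_hull (\bigcup_(y in ecball x delta) clarke_subdifferential f y).

Definition goldstein_stationary (R : realType) (d : nat) (delta eps : R)
    (f : 'rV[R]_d -> R) (x : 'rV[R]_d) : Prop :=
  (ereal_inf [set (enorm g)%:E | g in goldstein_subdifferential delta f x]
     <= eps%:E)%E.

Definition function_class (R : realType) (d : nat) (L Delta : R)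
    (x0 : 'rV[R]_d) : set ('rV[R]_d -> R) :=
  [set f | [/\ elipschitz_on L setT f,
               has_lbound (range f) &
               f x0 - inf (range f) <= Delta]].

Record input (R : realType) (d : nat) := Input {
  input_L : R;
  input_Delta : R;
  input_x0 : 'rV[R]_d;
  input_delta : R;
  input_eps : R
}.

Record response (R : realType) (d : nat) := Response {
  response_fun :> 'rV[R]_d -> R;
  response_lipschitz : locally_lipschitz response_fun
}.

(* Queries with their responses, oldest first. *)
Definition history (R : realType) (d : nat) := seq ('rV[R]_d * response R d).

(* [Diverge]: compute forever without any further query or return. *)
Inductive action (R : realType) (d : nat) :=
  | Query of 'rV[R]_d
  | Return of 'rV[R]_d
  | Diverge.
Arguments Diverge {R d}.

Definition same_germ (R : realType) (d : nat) (q : 'rV[R]_d)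
    (f g : 'rV[R]_d -> R) : Prop :=
  exists2 nu : R, 0 < nu & {in ecball q nu, f =1 g}.

Definition same_local_information (R : realType) (d : nat)
    (H1 H2 : history R d) : Prop :=
  List.Forall2
    (fun a b : 'rV[R]_d * response R d => a.1 = b.1 /\ same_germ a.1 a.2 b.2)
    H1 H2.

(* Internal computation is unrestricted: only the dependence of the next action
   on the input and on the local information received so far is recorded. *)
Record algorithm (R : realType) := Algorithm {
  next_action :> forall d : nat, input R d -> history R d -> action R d;
  first_query : forall (d : nat) (i : input R d),
    next_action i [::] = Query (input_x0 i);
  next_action_local : forall (d : nat) (i : input R d) (H1 H2 : history R d),
    same_local_information H1 H2 -> next_action i H1 = next_action i H2
}.

(* [transcript A i f H]: [H] is a history of an execution of [A] on [f] against
   some admissible oracle. *)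
Inductive transcript (R : realType) (d : nat) (A : algorithm R)
    (i : input R d) (f : 'rV[R]_d -> R) : history R d -> Prop :=
  | transcript_nil : transcript A i f [::]
  | transcript_rcons (H : history R d) (q : 'rV[R]_d) (h : response R d) :
      transcript A i f H -> A d i H = Query q -> same_germ q h f ->
      transcript A i f (rcons H (q, h)).

(* The set below has at most one element, by [transcript_return_unique], and
   [ereal_inf set0 = +oo]. *)
Definition query_count (R : realType) (d : nat) (A : algorithm R)
    (i : input R d) (f : 'rV[R]_d -> R) : \bar R :=
  ereal_inf [set ((size H)%:R : R)%:E | H in
    [set H : history R d | transcript A i f H /\
       exists2 z, A d i H = Return z &
         goldstein_stationary (input_delta i) (input_eps i) f z]].

Definition T_det (R : realType) (d : nat) (L Delta delta eps : R)
    (x0 : 'rV[R]_d) : \bar R :=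
  ereal_inf [set
    ereal_sup [set query_count A (Input L Delta x0 delta eps) f
              | f in function_class L Delta x0]
    | A in [set: algorithm R]].
Arguments T_det {R} d L Delta delta eps x0.

Lemma same_germ_common (R : realType) (d : nat) (q : 'rV[R]_d)
    (f g h : 'rV[R]_d -> R) :
  same_germ q f h -> same_germ q g h -> same_germ q f g.
Proof.
move=> [r r0 fh] [s s0 gh]; exists (Num.min r s); first by rewrite lt_min r0.
by move=> y /[!inE] /=; rewrite /ecball /= le_min => /andP[yr ys];
  rewrite fh ?gh ?inE.
Qed.

Lemma transcript_take (R : realType) (d : nat) (A : algorithm R)
    (i : input R d) (f : 'rV[R]_d -> R) (H : history R d) (n : nat) :
  transcript A i f H -> transcript A i f (take n H).
Proof.
elim=> [|H' q h tH IH AH hf]; first exact: transcript_nil.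
have [nH|nH] := leqP n (size H'); first by rewrite -cats1 takel_cat.
rewrite take_oversize ?size_rcons //.
exact: transcript_rcons.
Qed.

Lemma transcript_same_local_information (R : realType) (d : nat)
    (A : algorithm R) (i : input R d) (f : 'rV[R]_d -> R)
    (H1 H2 : history R d) :
  transcript A i f H1 -> transcript A i f H2 -> size H1 = size H2 ->
  same_local_information H1 H2.
Proof.
move=> t1; elim: t1 H2 => [|H1' q1 h1 t1 IH A1 g1] H2 t2.
  by case: H2 t2 => // _ _; exact: List.Forall2_nil.
case: t2 => [|H2' q2 h2 t2 A2 g2]; rewrite !size_rcons // => -[s12].
have l12 := IH _ t2 s12; move: A1; rewrite (next_action_local A i l12) A2.
move=> -[qq]; move: g2; rewrite qq => g2.
rewrite -!cats1; apply: List.Forall2_app => //.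
apply: List.Forall2_cons; last exact: List.Forall2_nil.
by split=> //=; exact: same_germ_common g1 g2.
Qed.

Lemma transcript_return_unique (R : realType) (d : nat) (A : algorithm R)
    (i : input R d) (f : 'rV[R]_d -> R) (H1 H2 : history R d)
    (z1 z2 : 'rV[R]_d) :
  transcript A i f H1 -> A d i H1 = Return z1 ->
  transcript A i f H2 -> A d i H2 = Return z2 ->
  size H1 = size H2 /\ z1 = z2.
Proof.
have le_size K1 K2 z : transcript A i f K1 -> A d i K1 = Return z ->
    transcript A i f K2 -> (size K2 <= size K1)%N.
  move=> t1 A1 t2; rewrite leqNgt; apply/negP => lt12.
  have := transcript_take (size K1).+1 t2.
  have := transcript_take (size K1) t2.
  have : size (take (size K1) K2) = size K1 by rewrite size_takel // ltnW.
  have : size (take (size K1).+1 K2) = (size K1).+1 by rewrite size_takel.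
  move=> s1 s0 t0 t3; case: t3 s1 t0 s0 => [//|K q h tK AK _].
  rewrite size_rcons => -[sK] t0 s0.
  have := transcript_same_local_information t1 tK (esym sK).
  by move=> /(next_action_local A i); rewrite A1 AK.
move=> t1 A1 t2 A2; have s12 : size H1 = size H2.
  by apply/eqP; rewrite eqn_leq (le_size _ _ _ t2 A2 t1) (le_size _ _ _ t1 A1).
split=> //; have := transcript_same_local_information t1 t2 s12.
by move=> /(next_action_local A i); rewrite A1 A2 => -[].
Qed.

(* Main.v *)
Require Import Defs.
From mathcomp Require Import all_boot all_order all_algebra.
From mathcomp Require Import all_classical all_reals all_analysis.
From mathcomp Require Import ring lra.
From mathcomp Require mpoly.

(** The upper bound comes from an algorithm using function values only.  By a
    packing argument ([pack_card]) the ball of radius [1 / 2] has a net of mesh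
    [1 / 32] with at most [33 ^ d] points.  Starting from the initial point,
    each round evaluates [f] on a translate of the net centered at the best point
    known so far.  Thirty-three rounds gaining [1 / 32] each would exceed the
    allowed gap between the initial value and the infimum, so some round gains
    less.  Around its center [x] the function then stays above [f x - 1 / 16] in
    the whole ball of radius [1 / 2].  Hence [f + enorm (_ - x) / 8] has an
    interior minimizer in that ball, where Fermat's rule gives a Clarke
    subgradient of norm at most [1 / 8]
    ([goldstein_stationary_small_decrease]); the subgradient is produced by the
    Hahn-Banach theorem applied to an infimal convolution of the Clarke
    derivative.

    The lower bound uses a resisting oracle: at every query [q] it answers with
    the germ of the fixed linear function [edot (_ - q) e].  After fewer than
    [N] queries and one output, at most [N] points matter.  If a unit direction [u]
    with [edot e u = 9 / 41] is far enough from all directions joining two of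
    these points, there is a 1-Lipschitz function with the announced germs,
    bounded below by [-1], that increases at rate [9 / 41 > 1 / 8] along [u]
    wherever it is larger than [-1]; none of the points is stationary for it
    ([exists_hard_function]).  The component of [u] orthogonal to [e] has to
    avoid at most [N ^ 2] cones of dimension [d - 1].  If this were
    impossible, the cones would cover the space, and the unit ball of dimension
    [d - 1] would be covered by [2 N ^ 2 + 1] balls of radius [2 / 7]; this
    requires at least [(7 / 2) ^ (d - 1)] balls ([cover_card]).

    The covering and packing inequalities are proved without volumes.  A
    covering or a packing can be reproduced inside each of its balls; after [L]
    generations a crude comparison with a grid loses a constant factor that does
    not depend on [L], and the [L]-th root removes it.

    Finally, at the fixed accuracy [(1 / 2, 1 / 8)] a polynomial in three
    variables has polynomial growth in [d], which the exponential lower bound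
    excludes. *)

Set Implicit Arguments.
Unset Strict Implicit.
Unset Printing Implicit Defensive.

Import Order.TTheory GRing.Theory Num.Theory.
Import numFieldNormedType.Exports.

Local Open Scope classical_set_scope.
Local Open Scope ring_scope.

(** * Euclidean geometry of row vectors *)

Section Euclid.
Variables (R : realType) (d : nat).
Implicit Types (u v w x y z : 'rV[R]_d) (a b r : R).

Lemma edotC u v : edot u v = edot v u.
Proof. by apply: eq_bigr => i _; rewrite mulrC. Qed.

Lemma edotDl u v w : edot (u + v) w = edot u w + edot v w.
Proof. by rewrite -big_split; apply: eq_bigr => i _; rewrite mxE mulrDl. Qed.

Lemma edotZl a u v : edot (a *: u) v = a * edot u v.
Proof. by rewrite mulr_sumr; apply: eq_bigr => i _; rewrite mxE mulrA. Qed.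

Lemma edotNl u v : edot (- u) v = - edot u v.
Proof. by rewrite -scaleN1r edotZl mulN1r. Qed.

Lemma edotBl u v w : edot (u - v) w = edot u w - edot v w.
Proof. by rewrite edotDl edotNl. Qed.

Lemma edotDr u v w : edot w (u + v) = edot w u + edot w v.
Proof. by rewrite !(edotC w) edotDl. Qed.

Lemma edotZr a u v : edot v (a *: u) = a * edot v u.
Proof. by rewrite !(edotC v) edotZl. Qed.

Lemma edotNr u v : edot v (- u) = - edot v u.
Proof. by rewrite !(edotC v) edotNl. Qed.

Lemma edotBr u v w : edot w (u - v) = edot w u - edot w v.
Proof. by rewrite edotDr edotNr. Qed.

Lemma edot0l u : edot 0 u = 0.
Proof. by rewrite -(scale0r 0) edotZl mul0r. Qed.

Definition edotE := (edotDl, edotDr, edotBl, edotBr, edotNl, edotNr, edotZl,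
  edotZr).

Lemma edot_ge0 u : 0 <= edot u u.
Proof. by apply: sumr_ge0 => i _; rewrite -expr2 sqr_ge0. Qed.

Lemma enorm_ge0 u : 0 <= enorm u.
Proof. exact: sqrtr_ge0. Qed.

Lemma sqr_enorm u : enorm u ^+ 2 = edot u u.
Proof. by rewrite sqr_sqrtr ?edot_ge0. Qed.

Lemma ler_enorm u r : 0 <= r -> (enorm u <= r) = (edot u u <= r ^+ 2).
Proof. by move=> r0; rewrite -sqr_enorm ler_pXn2r ?nnegrE ?enorm_ge0. Qed.

Lemma enorm0 : enorm (0 : 'rV[R]_d) = 0.
Proof. by rewrite /enorm edot0l sqrtr0. Qed.

Lemma enorm_eq0 u : (enorm u == 0) = (u == 0).
Proof.
apply/idP/eqP => [|->]; last by rewrite enorm0.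
rewrite -(@eqrXn2 _ 2) ?enorm_ge0 // sqr_enorm expr0n /= psumr_eq0 => [|i _].
  move=> /allP u0; apply/rowP => i; apply/eqP; rewrite mxE.
  by have := u0 i; rewrite mem_index_enum -expr2 sqrf_eq0 => /(_ isT)/eqP ->.
by rewrite -expr2 sqr_ge0.
Qed.

Lemma enorm_gt0 u : (0 < enorm u) = (u != 0).
Proof. by rewrite lt_def enorm_eq0 enorm_ge0 andbT. Qed.

Lemma enormZ a u : enorm (a *: u) = `|a| * enorm u.
Proof.
by rewrite /enorm edotZl edotZr mulrA -expr2 sqrtrM ?sqr_ge0 // sqrtr_sqr.
Qed.

Lemma enormN u : enorm (- u) = enorm u.
Proof. by rewrite -scaleN1r enormZ normrN1 mul1r. Qed.

Lemma enormC u v : enorm (u - v) = enorm (v - u).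
Proof. by rewrite -enormN opprB. Qed.

Lemma sqr_edot_le u v : edot u v ^+ 2 <= edot u u * edot v v.
Proof.
have [->|v0] := eqVneq v 0; first by rewrite edotC !edot0l expr0n mulr0.
have vv : 0 < edot v v by rewrite -sqr_enorm exprn_gt0 // enorm_gt0.
have := edot_ge0 (edot v v *: u - edot u v *: v).
rewrite !edotE (edotC v u) => h.
rewrite -subr_ge0 -(pmulr_rge0 _ vv); apply: le_trans h _.
by rewrite le_eqVlt; apply/orP; left; apply/eqP; ring.
Qed.

Lemma norm_edot_le u v : `|edot u v| <= enorm u * enorm v.
Proof.
rewrite -sqrtrM ?edot_ge0 // -sqrtr_sqr ler_sqrt ?sqr_edot_le //.
by rewrite mulr_ge0 ?edot_ge0.
Qed.

Lemma edot_le u v : edot u v <= enorm u * enorm v.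
Proof. exact: le_trans (ler_norm _) (norm_edot_le u v). Qed.

Lemma ler_enormD u v : enorm (u + v) <= enorm u + enorm v.
Proof.
rewrite ler_enorm ?addr_ge0 ?enorm_ge0 // !edotE (edotC v u).
by have := edot_le u v; rewrite -!sqr_enorm; lra.
Qed.

Lemma ler_enorm_dist u v w : enorm (u - w) <= enorm (u - v) + enorm (v - w).
Proof. by have := ler_enormD (u - v) (v - w); rewrite addrA subrK. Qed.

Lemma ler_enormB u v : enorm u - enorm v <= enorm (u - v).
Proof. by rewrite lerBlDr; have := ler_enormD (u - v) v; rewrite subrK. Qed.

Lemma dist_enorm_le u v : `|enorm u - enorm v| <= enorm (u - v).
Proof.
rewrite ler_norml ler_enormB andbT; have := ler_enormB v u.
by rewrite enormC; lra.
Qed.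

Lemma coord_le_enorm u i : `|u 0 i| <= enorm u.
Proof.
rewrite -sqrtr_sqr ler_sqrt ?edot_ge0 // /edot (bigD1 i) //= expr2 lerDl.
by apply: sumr_ge0 => j _; rewrite -expr2 sqr_ge0.
Qed.

Lemma enorm_le_coord u r : 0 <= r -> (forall i, `|u 0 i| <= r) ->
  enorm u <= Num.sqrt d%:R * r.
Proof.
move=> r0 ur; rewrite ler_enorm ?mulr_ge0 ?sqrtr_ge0 //.
rewrite exprMn sqr_sqrtr // mulr_natl -[d in X in _ <= X]card_ord -sumr_const.
apply: ler_sum => i _; rewrite -expr2 -(real_normK (num_real (u 0 i))).
by rewrite ler_pXn2r ?nnegrE.
Qed.

(** The norm of row vectors is the sup norm, so that the Euclidean balls have to
    be compared with the balls defining the topology. *)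
Lemma nbhs_ecballP x (A : set 'rV[R]_d) :
  nbhs x A <-> exists2 r, 0 < r & ecball x r `<=` A.
Proof.
split=> [/nbhs_ballP[e /= e0 xeA]|[r r0 xrA]].
  exists (e / 2); first by rewrite divr_gt0.
  move=> y xy; apply: xeA; split=> // i j; rewrite ord1 /ball /= distrC.
  have := coord_le_enorm (y - x) j; rewrite !mxE; move: xy; rewrite /ecball /=.
  have e2 : e / 2 < e by lra.
  by move=> xy c; lra.
apply/nbhs_ballP; exists (r / (Num.sqrt d%:R + 1)).
  by rewrite /= divr_gt0 // ltr_wpDl ?sqrtr_ge0.
move=> y [e0 xy]; apply: xrA; rewrite /ecball /=.
apply: le_trans (@enorm_le_coord _ (r / (Num.sqrt d%:R + 1)) _ _) _.
- exact: ltW.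
- by move=> i; rewrite !mxE distrC ltW // xy.
- have s0 : 0 <= Num.sqrt d%:R :> R by exact: sqrtr_ge0.
  by rewrite mulrCA ger_pMr // ler_pdivrMr; lra.
Qed.

Lemma elipschitz_continuous L (f : 'rV[R]_d -> R) :
  elipschitz_on L setT f -> continuous f.
Proof.
move=> fL x A /nbhs_ballP[e /= e0 eA]; apply/nbhs_ecballP.
have L0 : 0 < 1 + `|L| by rewrite ltr_pwDl.
exists (e / (1 + `|L|)); first by rewrite divr_gt0.
move=> y; rewrite /ecball /= enormC ler_pdivlMr // => xy; apply: eA.
rewrite /ball /=; have [<-|xny] := eqVneq x y; first by rewrite subrr normr0.
have n0 : 0 < enorm (x - y) by rewrite enorm_gt0 subr_eq0.
apply: le_lt_trans (fL x y I I) _; apply: lt_le_trans xy.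
by rewrite mulrC ltr_pM2l // (le_lt_trans (ler_norm L)) // ltrDr.
Qed.

Lemma elipschitz_enorm_dist x : elipschitz_on 1 setT (fun y => enorm (y - x)).
Proof.
move=> y z _ _; rewrite mul1r; apply: le_trans (dist_enorm_le _ _) _.
by rewrite opprB addrA subrK.
Qed.

Lemma compact_ecball x r : compact (ecball x r).
Proof.
apply: bounded_closed_compact.
  exists (enorm x + r); split; first exact: num_real.
  move=> M ltM y; rewrite /ecball /= => yx.
  have yM i : `|y 0 i| <= M.
    apply: le_trans (coord_le_enorm y i) _.
    by have := ler_enormB y x; lra.
  rewrite [leLHS](_ : _ = mx_norm y) //; have [->|i] := eqVneq (mx_norm y) 0.
    apply: le_trans (ltW ltM); apply: addr_ge0; first exact: enorm_ge0.
    exact: le_trans (enorm_ge0 _) yx.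
  have [[a b] ->] := mx_norm_neq0 i.
  by rewrite ord1.
have cx : continuous (fun y : 'rV[R]_d => enorm (y - x)).
  exact: elipschitz_continuous (elipschitz_enorm_dist x).
rewrite (_ : ecball x r = (fun y => enorm (y - x)) @^-1` [set t | t <= r]) //.
by apply: closed_comp; [move=> y _; exact: cx | exact: closed_le].
Qed.

End Euclid.

(** * Clarke directional derivatives through difference quotients *)

Section Clarke.
Variables (R : realType) (d : nat).
Implicit Types (f : 'rV[R]_d -> R) (g u v w x y z : 'rV[R]_d).

(** The real upper bounds of the difference quotients near [x]: the Clarke
    derivative is their infimum.  Working with them avoids extended reals. *)
Definition quotient_bound f x v (r c : R) :=
  forall y t, ecball x r y -> 0 < t -> t < r -> f (y + t *: v) - f y <= c * t.

Lemma clarke_derivative_le f x v r c : 0 < r -> quotient_bound f x v r c ->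
  (clarke_derivative f x v <= c%:E)%E.
Proof.
move=> r0 b; pose A := ecball x r `*` [set t : R | 0 < t /\ t < r].
apply: (@le_trans _ _ (ereal_sup
    [set ((f (p.1 + p.2 *: v) - f p.1) / p.2)%:E | p in A])).
  apply: ereal_inf_lbound; exists A => //.
  exists (ecball x r, [set t | 0 < t /\ t < r]) => //; split => /=.
    by apply/nbhs_ecballP; exists r.
  by near=> t; split => //; near: t; exact: nbhs_right_lt.
apply: ge_ereal_sup => _ [[y t] /= [xy [t0 tr]] <-].
by rewrite lee_fin ler_pdivrMr // b.
Unshelve. all: by end_near. Qed.

Lemma le_clarke_derivative f x v (b : R) :
  (forall r c, 0 < r -> quotient_bound f x v r c -> b <= c) ->
  (b%:E <= clarke_derivative f x v)%E.
Proof.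
move=> h; apply: le_ereal_inf_tmp => _ [A [[B C] /= [xB C0] BCA] <-].
have [r r0 rB] := (nbhs_ecballP _ _).1 xB.
have [e /= e0 eC] := C0.
set s := ereal_sup _.
have [/eqP|] := boolP (s == +oo%E); first by move=> ->; rewrite leey.
have key y t : ecball x (Num.min r (e / 2)) y -> 0 < t ->
    t < Num.min r (e / 2) ->
    ((((f (y + t *: v) - f y) / t)%:E <= s)%E).
  rewrite /ecball /= le_min lt_min => /andP[xy _] t0 /andP[_ te].
  apply: ereal_sup_ubound; exists (y, t) => //; apply: BCA; split => /=.
    exact: rB.
  by apply: eC => //=; rewrite sub0r normrN gtr0_norm //; lra.
case: s key => [s| |] key // _; last first.
  set m := Num.min r (e / 2) in key.
  have m0 : 0 < m by rewrite lt_min r0 divr_gt0.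
  have := key x (m / 2); rewrite leeNy_eq /ecball /= subrr enorm0 ltW //.
  by rewrite divr_gt0 // (_ : m / 2 < m) => [/(_ isT isT isT)//|]; lra.
rewrite lee_fin; apply: (h (Num.min r (e / 2))).
  by rewrite lt_min r0 divr_gt0.
by move=> y t xy t0 tr; have := key y t xy t0 tr; rewrite lee_fin ler_pdivrMr.
Qed.

End Clarke.

(** * Linear minorants of sublinear functions *)

Section HahnBanach.
Variables (R : realType) (d : nat).
Implicit Types (p q : 'rV[R]_d -> R) (e u v w : 'rV[R]_d).

Definition sublinear p :=
  (forall u v, p (u + v) <= p u + p v) /\
  (forall (t : R) u, 0 < t -> p (t *: u) = t * p u).

Lemma sublinear0 p : sublinear p -> p 0 = 0.
Proof. by move=> [_ pZ]; have := pZ 2 0 (ltr0Sn _ 1); rewrite scaler0; lra. Qed.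

Lemma sublinear_oppr p v : sublinear p -> - p (- v) <= p v.
Proof.
by move=> sp; have := sp.1 v (- v); rewrite subrr sublinear0 //; lra.
Qed.

(** Straightening a sublinear function along [e]: the largest sublinear
    minorant which is additive in the direction [e] is the infimum of
    [p (v + t e) - t p e] over [t >= 0]. *)
Lemma sublinear_straighten p e : sublinear p ->
  exists q, [/\ sublinear q, forall v, q v <= p v & q (- e) = - q e].
Proof.
move=> sp; have [pD pZ] := sp; have p0 := sublinear0 sp.
pose S v := [set p (v + t *: e) - t * p e | t in [set t : R | 0 <= t]].
have Slb v : lbound (S v) (- p (- v)).
  move=> _ [t /= t0 <-]; have : p (t *: e) = t * p e.
    by have [->|t1] := eqVneq t 0; rewrite ?scale0r ?mul0r // pZ // lt_def t1.
  by have := pD (v + t *: e) (- v); rewrite addrAC subrr add0r; lra.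
have Sn0 v : S v !=set0 by exists (p (v + 0 *: e) - 0 * p e); exists 0 => /=.
pose q v := inf (S v).
have qle v t : 0 <= t -> q v <= p (v + t *: e) - t * p e.
  by move=> t0; apply: ge_inf; [exists (- p (- v)) | exists t].
have le_q v b : (forall t, 0 <= t -> b <= p (v + t *: e) - t * p e) ->
    b <= q v.
  by move=> h; apply: lb_le_inf => // _ [t /= t0 <-]; exact: h.
have qp v : q v <= p v.
  by have := qle v 0 (lexx _); rewrite scale0r addr0 mul0r subr0.
have qD u v : q (u + v) <= q u + q v.
  rewrite -lerBlDr; apply: (le_q) => t t0.
  rewrite lerBlDr -lerBlDl; apply: (le_q) => s s0.
  have := qle (u + v) (t + s) (addr_ge0 t0 s0).
  have := pD (u + t *: e) (v + s *: e); rewrite addrACA -scalerDl.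
  by lra.
have qZle t u : 0 < t -> q (t *: u) <= t * q u.
  move=> t0; rewrite -ler_pdivrMl //; apply: (le_q) => s s0.
  rewrite ler_pdivrMl // mulrBr -pZ // scalerDr scalerA mulrA.
  by apply: qle; rewrite mulr_ge0 // ltW.
have sq : sublinear q.
  split=> // t u t0; apply/eqP; rewrite eq_le qZle //=.
  have := qZle t^-1 (t *: u); rewrite invr_gt0 scalerA mulVf ?gt_eqF // scale1r.
  by move=> /(_ t0); rewrite ler_pdivlMl.
exists q; split=> //; apply/eqP; rewrite eq_le; apply/andP; split.
  have := qle (- e) 1 ler01; rewrite scale1r addNr p0 mul1r sub0r.
  by move=> h; apply: le_trans h _; rewrite lerN2 qp.
by have := sublinear_oppr (- e) sq; rewrite (opprK e).
Qed.

(** Straightening [p] along the vectors of a basis makes it additive along all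
    of them, hence linear. *)
Lemma hahn_banach p : sublinear p -> exists g, forall v, edot g v <= p v.
Proof.
move=> sp.
have [q [sq qp qe]] : exists q, [/\ sublinear q, forall v, q v <= p v &
    forall w, w \in [seq delta_mx 0 i | i <- enum 'I_d] -> q (- w) = - q w].
  elim: [seq _ | _ <- _] => [|e l [q [sq qp ql]]]; first by exists p.
  have [r [sr rq re]] := sublinear_straighten e sq.
  exists r; split=> // [v|w]; first exact: le_trans (qp v).
  rewrite inE => /orP[/eqP -> //|/ql qw].
  by have := sublinear_oppr (- w) sr; have := rq w; have := rq (- w);
    rewrite opprK qw; lra.
exists (\row_i q (delta_mx 0 i)) => v; set g := \row_i _.
have qg w : q w <= edot g w.
  rewrite [w in q w]row_sum_delta /edot.
  elim/big_ind2: _ => [|x a y b qx qy|i _]; first by rewrite sublinear0.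
    by apply: le_trans (sq.1 _ _) _; exact: lerD.
  rewrite mxE mulrC; have [w0|w0|<-] := ltgtP 0 (w 0 i).
  - by rewrite sq.2.
  - rewrite -[w 0 i]opprK scaleNr -scalerN sq.2 ?oppr_gt0 // qe.
      by rewrite mulrNN opprK.
    by rewrite map_f // mem_enum.
  - by rewrite scale0r mul0r sublinear0.
apply: le_trans (qp v); apply: le_trans (sublinear_oppr v sq).
by rewrite lerNr -edotNr qg.
Qed.

End HahnBanach.

(** * A sufficient condition for Goldstein stationarity *)

Section Stationarity.
Variables (R : realType) (d : nat) (f : 'rV[R]_d -> R).
Hypothesis fL : elipschitz_on 1 setT f.
Implicit Types (g u v w x y z : 'rV[R]_d).

(** The Clarke derivative is sublinear even though [f] is not: the quotient
    along [u + v] splits at [y + t u], which is still close to [x]. *)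
Lemma quotient_boundD x u v (r s b c : R) : 0 < r -> 0 < s ->
  quotient_bound f x u r b -> quotient_bound f x v s c ->
  exists2 m, 0 < m & quotient_bound f x (u + v) m (b + c).
Proof.
move=> r0 s0 bu cv; pose m := Num.min r s / (1 + enorm u).
have u1 : 0 < 1 + enorm u by rewrite ltr_pwDl ?enorm_ge0.
have rs0 : 0 < Num.min r s by rewrite lt_min r0.
have mE : m * (1 + enorm u) = Num.min r s by rewrite divfK // gt_eqF.
have m0 : 0 < m by rewrite divr_gt0.
have mrs : m <= Num.min r s.
  by rewrite -mE ler_pMr // lerDl enorm_ge0.
move: (mrs); rewrite le_min => /andP[mr ms].
exists m => // y t xy t0 tm; rewrite scalerDr addrA.
have yu : ecball x s (y + t *: u).
  rewrite /ecball /=; apply: (@le_trans _ _ (Num.min r s)).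
    rewrite addrAC; apply: le_trans (ler_enormD _ _) _; rewrite -mE mulrDr mulr1.
    by rewrite lerD // enormZ gtr0_norm // ler_wpM2r ?enorm_ge0 // ltW.
  by rewrite ge_min lexx orbT.
have h1 := cv _ t yu t0 (lt_le_trans tm ms).
have h2 := bu y t (le_trans xy mr) t0 (lt_le_trans tm mr).
by lra.
Qed.

Lemma quotient_boundZ x v (r a c : R) : 0 < r -> 0 < a ->
  quotient_bound f x v r c ->
  exists2 m, 0 < m & quotient_bound f x (a *: v) m (a * c).
Proof.
move=> r0 a0 b; exists (Num.min r (r / a)); first by rewrite lt_min r0 divr_gt0.
move=> y t; rewrite /ecball /= le_min => /andP[xr _] t0.
rewrite lt_min => /andP[_ tra].
rewrite scalerA (mulrC a) -mulrA (mulrC a); apply: b; rewrite ?mulr_gt0 //.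
by rewrite -ltr_pdivlMr.
Qed.

(** Fermat's rule for the sum of [f] and the cone [e * enorm (_ - x)]: zero
    lies in the sum of the Clarke subdifferential of [f] and of the ball of
    radius [e].  The point of that sum is a linear minorant of the infimal
    convolution of the Clarke derivative and of [e * enorm _]. *)
Lemma clarke_fermat x (r e : R) : 0 < r -> 0 <= e ->
  (forall y, ecball x r y -> f x <= f y + e * enorm (y - x)) ->
  exists2 g, clarke_subdifferential f x g & enorm g <= e.
Proof.
move=> r0 e0 fx.
pose S v := [set b : R | exists c w, b = c + e * enorm w /\
  exists2 s, 0 < s & quotient_bound f x (v - w) s c].
have Slb v : lbound (S v) (- (e * enorm v)).
  move=> _ [c [w [-> [s s0 b]]]].
  pose t := Num.min s (Num.min r (r / (1 + enorm (v - w)))) / 2.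
  have u1 : 0 < 1 + enorm (v - w) by rewrite ltr_pwDl ?enorm_ge0.
  have m0 : 0 < Num.min s (Num.min r (r / (1 + enorm (v - w)))).
    by rewrite !lt_min s0 r0 divr_gt0.
  have t0 : 0 < t by rewrite divr_gt0.
  have : t < Num.min s (Num.min r (r / (1 + enorm (v - w)))).
    by rewrite /t; lra.
  rewrite !lt_min => /and3P[ts tr]; rewrite ltr_pdivlMr // => tw.
  have xs : ecball x s x by rewrite /ecball /= subrr enorm0 ltW.
  have := b x t xs t0 ts.
  have xr : ecball x r (x + t *: (v - w)).
    rewrite /ecball /= addrC addKr enormZ gtr0_norm //; move: tw.
    by rewrite mulrDr mulr1; lra.
  have := fx _ xr; rewrite [_ - x]addrC addKr enormZ gtr0_norm // => h1 h2.
  have : - (e * enorm (v - w)) <= c.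
    rewrite -(ler_pM2r t0); move: h1 h2.
    by rewrite (mulrCA e) mulNr (mulrC t); lra.
  have : e * enorm (v - w) <= e * (enorm v + enorm w).
    by apply: ler_wpM2l => //; rewrite -(enormN w) ler_enormD.
  by rewrite mulrDr; lra.
have hlb v : has_lbound (S v) by exists (- (e * enorm v)); exact: Slb.
have SL v w : S v (enorm (v - w) + e * enorm w).
  exists (enorm (v - w)), w; split=> //; exists 1 => // y t _ t0 _.
  apply: le_trans (ler_norm _) _; apply: le_trans (fL I I) _.
  by rewrite addrC addKr enormZ mul1r gtr0_norm // mulrC.
pose q v := inf (S v).
have le_q v b : (forall c, S v c -> b <= c) -> b <= q v.
  by move=> h; apply: lb_le_inf => //; exact: ex_intro (SL v 0).
have q_le v c : S v c -> q v <= c by move=> Sc; apply: ge_inf.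
have qD u v : q (u + v) <= q u + q v.
  rewrite -lerBlDr; apply: (le_q) => _ [b [w [-> [s s0 bs]]]].
  rewrite lerBlDr -lerBlDl; apply: (le_q) => _ [c [z [-> [t t0 ct]]]].
  have [m m0 bc] := quotient_boundD s0 t0 bs ct.
  have := q_le (u + v) (b + c + e * enorm (w + z)).
  have : e * enorm (w + z) <= e * (enorm w + enorm z).
    by rewrite ler_wpM2l // ler_enormD.
  rewrite lerBlDl mulrDr => h1 /(_ _)/le_trans; apply; last by lra.
  exists (b + c), (w + z); split=> //; exists m => //.
  by rewrite opprD addrACA.
have qZle t v : 0 < t -> q (t *: v) <= t * q v.
  move=> t0; rewrite -ler_pdivrMl //; apply: (le_q) => _ [c [w [-> [s s0 cs]]]].
  rewrite ler_pdivrMl //; have [m m0 cm] := quotient_boundZ s0 t0 cs.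
  apply: q_le; exists (t * c), (t *: w); split.
    by rewrite enormZ gtr0_norm // mulrDr mulrCA.
  by exists m => //; rewrite -scalerBr.
have sq : sublinear q.
  split=> // t u t0; apply/eqP; rewrite eq_le qZle //=.
  have := qZle t^-1 (t *: u); rewrite invr_gt0 scalerA mulVf ?gt_eqF // scale1r.
  by move=> /(_ t0); rewrite ler_pdivlMl.
have [g gq] := hahn_banach sq; exists g.
  move=> v; apply: le_clarke_derivative => s c s0 cs.
  apply: le_trans (gq v) _; apply: q_le; exists c, 0.
  by rewrite enorm0 mulr0 addr0 subr0; split=> //; exists s.
have := le_trans (gq g) (q_le _ _ (SL g g)).
rewrite subrr enorm0 add0r -sqr_enorm.
have [->//|g0] := eqVneq (enorm g) 0.
by rewrite expr2 ler_pM2r // lt_def g0 enorm_ge0.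
Qed.

Lemma sub_convex_hull (A : set 'rV[R]_d) : A `<=` convex_hull A.
Proof. exact: sub_smallest. Qed.

(** The function [f + eps * enorm (_ - x)] is larger on the boundary of the ball
    than at its center, so that it has an interior minimizer, where Fermat's
    rule applies. *)
Lemma goldstein_stationary_small_decrease x (delta eps : R) :
  0 < delta -> 0 <= eps ->
  (forall y, ecball x delta y -> f x - delta * eps < f y) ->
  goldstein_stationary delta eps f x.
Proof.
move=> d0 e0 fx.
have phiL : elipschitz_on (1 + eps) setT (fun y => f y + eps * enorm (y - x)).
  move=> y z _ _; rewrite opprD addrACA -mulrBr mulrDl.
  apply: le_trans (ler_normD _ _) _; rewrite lerD ?fL // normrM ger0_norm //.
  rewrite ler_wpM2l //; apply: le_trans (elipschitz_enorm_dist x I I) _.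
  by rewrite mul1r.
have [|z xz zmin] := EVT_min_rV _ (@compact_ecball _ _ x delta)
    (continuous_subspaceT (elipschitz_continuous phiL)).
  by exists x; rewrite /ecball /= subrr enorm0 ltW.
have xx : ecball x delta x by rewrite /ecball /= subrr enorm0 ltW.
rewrite inE in xz.
have zd : enorm (z - x) < delta.
  rewrite lt_neqAle; apply/andP; split; last exact: xz.
  apply/eqP => zd; have := zmin x; rewrite inE => /(_ xx).
  by have := fx z xz; rewrite subrr enorm0 mulr0 zd; lra.
have [|y yz|g gf ge] := @clarke_fermat z (delta - enorm (z - x)) eps _ e0.
- by rewrite subr_gt0.
- have xy : ecball x delta y.
    by have := ler_enorm_dist y z x; move: yz; rewrite /ecball /=; lra.
  have := zmin y; rewrite inE => /(_ xy).
  have : eps * enorm (y - x) <= eps * (enorm (y - z) + enorm (z - x)).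
    by rewrite ler_wpM2l // ler_enorm_dist.
  by rewrite mulrDr; lra.
apply: le_trans (_ : (enorm g)%:E <= _)%E; last by rewrite lee_fin.
apply: ereal_inf_lbound; exists g => //; apply: sub_convex_hull.
by exists z.
Qed.

End Stationarity.

(** * Covering and packing of a ball by smaller balls *)

Section CoverPack.
Variables (R : realType) (n : nat).
Implicit Types (x y : 'rV[R]_n).

Lemma ge1_of_expr_lbound (C x : R) : 0 < C -> 0 <= x ->
  (forall L : nat, C <= x ^+ L) -> 1 <= x.
Proof.
move=> C0 x0 h; rewrite leNgt; apply/negP => x1.
have : (fun L => x ^+ L) @ \oo --> (0 : R).
  by apply: cvg_expr; rewrite ger0_norm.
move=> /cvgrPdist_lt/(_ _ C0)[N _ /(_ N (leqnn N))] /=.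
by rewrite sub0r normrN ger0_norm ?exprn_ge0 // ltNge h.
Qed.

Lemma natr_dist_ge1 (i j : nat) : i != j -> 1 <= `|i%:R - j%:R : R|.
Proof.
wlog ij : i j / (i < j)%N => [h|_].
  by rewrite neq_ltn => /orP[] ij; [|rewrite distrC]; apply: h; rewrite ?ltn_eqF.
rewrite distrC ger0_norm; last by rewrite subr_ge0 ler_nat ltnW.
by rewrite lerBrDr nat1r ler_nat.
Qed.

(* One more than the constant comparing the two norms, hence nonzero even in
   dimension zero. *)
Let D : R := Num.sqrt n%:R + 1.

Let D1 : 1 <= D. Proof. by rewrite lerDr sqrtr_ge0. Qed.
Let D0 : 0 < D. Proof. exact: lt_le_trans D1. Qed.

(** The points of a grid of mesh larger than [2 * rho] need distinct balls. *)
Lemma grid_cover_card (J : finType) (c : J -> 'rV[R]_n) (rho : R) (m : nat) :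
  (forall x, enorm x <= 1 -> exists j, enorm (x - c j) <= rho) ->
  2 * rho * m.+1%:R * D < 1 -> (m.+1 ^ n <= #|J|)%N.
Proof.
move=> cov small.
pose p (t : {ffun 'I_n -> 'I_m.+1}) : 'rV[R]_n :=
  \row_i ((t i)%:R / (m.+1%:R * D)).
have m0 : 0 < m.+1%:R :> R by rewrite ltr0n.
have mD : 0 < m.+1%:R * D by rewrite mulr_gt0.
have p1 t : enorm (p t) <= 1.
  apply: le_trans (@enorm_le_coord _ _ (p t) D^-1 _ _) _.
  - by rewrite invr_ge0 ltW.
  - move=> i; rewrite mxE ger0_norm; last by rewrite divr_ge0 // ltW.
    rewrite ler_pdivrMr // mulrC mulfK ?gt_eqF // ler_nat.
    exact: ltnW (ltn_ord _).
  - by rewrite ler_pdivrMr // mul1r lerDl.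
have [phi phiP] := choice (fun t => cov _ (p1 t)).
have phi_inj : injective phi.
  move=> s t st; apply/ffunP => i; apply/val_inj/eqP.
  apply: contraTT small => /natr_dist_ge1 h; rewrite -leNgt.
  have := coord_le_enorm (p s - p t) i; rewrite !mxE -mulrBl normrM.
  rewrite normfV (gtr0_norm mD) ler_pdivrMr // => h2.
  have : enorm (p s - p t) <= 2 * rho.
    apply: le_trans (ler_enorm_dist _ (c (phi s)) _) _.
    by have := phiP s; have := phiP t; rewrite -st (enormC (c _)); lra.
  by rewrite -(ler_pM2r mD); lra.
by have := leq_card phi phi_inj; rewrite card_ffun !card_ord.
Qed.

(** Points at distance at least [2 * rho] from each other lie in distinct
    cells of a grid of mesh [rho / D]. *)
Lemma grid_pack_card (J : finType) (c : J -> 'rV[R]_n) (rho : R) :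
  0 < rho -> rho <= 1 -> (forall j, enorm (c j) <= 1) ->
  (forall i j, i != j -> 2 * rho <= enorm (c i - c j)) ->
  #|J|%:R <= (3 * D / rho) ^+ n.
Proof.
move=> r0 r1 c1 sep; pose m := Num.trunc (2 * D / rho).
have cell_ge0 j i : 0 <= (c j 0 i + 1) * D / rho.
  rewrite divr_ge0 ?(ltW r0) // mulr_ge0 ?(ltW D0) //.
  by have := coord_le_enorm (c j) i; have := c1 j; rewrite ler_norml; lra.
have cellP j (i : 'I_n) : (Num.trunc ((c j 0 i + 1) * D / rho)%R < m.+1)%N.
  rewrite ltnS le_truncn // ler_pM2r ?invr_gt0 // ler_pM2r //.
  by have := coord_le_enorm (c j) i; have := c1 j; rewrite ler_norml; lra.
pose phi j := [ffun i => Ordinal (cellP j i)].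
have phi_inj : injective phi.
  move=> a b /ffunP ab; apply/eqP; apply/negPn/negP => /sep; apply/negP.
  rewrite -ltNge; apply: (@le_lt_trans _ _ (Num.sqrt n%:R * (rho / D))).
    apply: enorm_le_coord => [|i]; first by rewrite divr_ge0 ?ltW.
    have := ab i; rewrite !ffunE => /(congr1 val) /= eq_cell.
    have /andP[la ua] := truncn_itv (cell_ge0 a i).
    have /andP[lb ub] := truncn_itv (cell_ge0 b i).
    rewrite eq_cell in la ua; rewrite -natr1 in ua ub.
    have : `|(c a 0 i + 1) * D / rho - (c b 0 i + 1) * D / rho| <= 1.
      by rewrite ler_norml; lra.
    rewrite -mulrBl -mulrBl normrM normfV (gtr0_norm r0) normrM (gtr0_norm D0).
    by rewrite !mxE ler_pdivrMr // ler_pdivlMr // mul1r opprD addrACA subrr addr0.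
  rewrite mulrA ltr_pdivrMr //.
  have : Num.sqrt n%:R < D by rewrite ltrDl.
  move=> sD; have : 0 < rho * D by rewrite mulr_gt0.
  by move: sD; rewrite -(ltr_pM2r r0); lra.
have m3 : m.+1%:R <= 3 * D / rho.
  have Dr : 1 <= D / rho by rewrite ler_pdivlMr // mul1r (le_trans r1).
  have : m%:R <= 2 * D / rho by rewrite truncn_le divr_ge0 ?mulr_ge0 // ltW.
  by rewrite -natr1; lra.
have := leq_card phi phi_inj; rewrite card_ffun !card_ord -(ler_nat R) natrX.
move=> h; apply: le_trans h _; apply: lerXn2r => //; rewrite nnegrE //.
exact: le_trans m3.
Qed.

Variables (I : finType) (c : I -> 'rV[R]_n) (lambda : R).
Hypotheses (l0 : 0 < lambda) (l1 : lambda < 1).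

(** The center of the ball of radius [lambda ^+ size s] reached by following
    the word [s] through the similarities sending the unit ball to the balls
    centered at the [c i]. *)
Definition word_center (s : seq I) : 'rV[R]_n :=
  foldr (fun i y => c i + lambda *: y) 0 s.

Lemma word_center_cover :
  (forall x, enorm x <= 1 -> exists i, enorm (x - c i) <= lambda) ->
  forall L x, enorm x <= 1 ->
  exists s : L.-tuple I, enorm (x - word_center s) <= lambda ^+ L.
Proof.
move=> cov; elim=> [|L IH] x x1.
  by exists [tuple]; rewrite /= subr0 expr0.
have [i xi] := cov x x1.
have [|s ys] := IH (lambda^-1 *: (x - c i)).
  by rewrite enormZ gtr0_norm ?invr_gt0 // mulrC ler_pdivrMr // mul1r.
exists (cons_tuple i s) => /=; rewrite opprD addrA.
have -> : x - c i - lambda *: word_center s =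
    lambda *: (lambda^-1 *: (x - c i) - word_center s).
  by rewrite scalerBr scalerA divff ?gt_eqF // scale1r.
by rewrite enormZ gtr0_norm // exprS ler_pM2l.
Qed.

(** Iterating the covering [L] times makes multiplicative constants, such as
    those lost by comparing balls with cubes, disappear as [L] grows. *)
Lemma cover_card :
  (forall x, enorm x <= 1 -> exists i, enorm (x - c i) <= lambda) ->
  1 <= #|I|%:R * lambda ^+ n.
Proof.
move=> cov; apply: (@ge1_of_expr_lbound ((6 * D)^-1 ^+ n)).
- by rewrite exprn_gt0 // invr_gt0 mulr_gt0.
- by rewrite mulr_ge0 // exprn_ge0 // ltW.
move=> L; have covL := word_center_cover cov L.
have lL : 0 < lambda ^+ L by rewrite exprn_gt0.
have DL : 0 < 3 * D * lambda ^+ L by rewrite !mulr_gt0.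
rewrite exprMn -exprM mulnC exprM -ler_pdivrMr ?exprn_gt0 //.
rewrite -expr_div_n.
set y := (3 * D * lambda ^+ L)^-1.
have -> : (6 * D)^-1 / lambda ^+ L = y / 2.
  by rewrite /y; field; rewrite !gt_eqF.
have y0 : 0 < y by rewrite invr_gt0.
have I0 : (0 < #|I|)%N.
  by have [|i _] := cov 0; [rewrite enorm0 | apply/card_gt0P; exists i].
have [y1|y1] := ltP y 1.
  apply: (@le_trans _ _ 1); last by rewrite exprn_ege1 // ler1n.
  by rewrite exprn_ile1 ?divr_ge0 ?ltW //; lra.
have [m my ym] : exists2 m, m.+1%:R <= y & y / 2 <= m.+1%:R.
  have /andP[ty yt] := truncn_itv (ltW y0).
  have := truncn_gt0 y; rewrite y1; case: (Num.trunc y) => // m in ty yt * => _.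
  have m1 : 1 <= m.+1%:R :> R by rewrite ler1n.
  by exists m => //; rewrite -natr1 in yt; lra.
have small : 2 * lambda ^+ L * m.+1%:R * D < 1.
  have := my; rewrite /y -[_^-1]mul1r ler_pdivlMr //.
  have : 0 < m.+1%:R * (D * lambda ^+ L) by rewrite !mulr_gt0 ?ltr0n.
  by lra.
have := grid_cover_card covL small; rewrite card_tuple -(ler_nat R) !natrX.
by apply: le_trans; apply: lerXn2r; rewrite ?nnegrE ?divr_ge0 // ltW.
Qed.

Hypothesis inside : forall i, enorm (c i) <= 1 - lambda.
Hypothesis separated : forall i j, i != j -> 2 * lambda <= enorm (c i - c j).

Lemma word_center_inside s : enorm (word_center s) <= 1 - lambda ^+ size s.
Proof.
elim: s => [|i s IH] /=; first by rewrite enorm0 expr0 subrr.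
apply: le_trans (ler_enormD _ _) _; rewrite enormZ gtr0_norm // exprS.
have := inside i; have : lambda * enorm (word_center s) <=
    lambda * (1 - lambda ^+ size s) by rewrite ler_pM2l.
by lra.
Qed.

Lemma word_center_separated s t : size s = size t -> s != t ->
  2 * lambda ^+ size s <= enorm (word_center s - word_center t).
Proof.
elim: s t => [|i s IH] [|j t] //= [st]; have [<-|ij _] := eqVneq i j.
  rewrite eqseq_cons eqxx /= => /(IH _ st) h.
  rewrite opprD addrACA subrr add0r -scalerBr enormZ gtr0_norm // exprS.
  by rewrite mulrCA ler_pM2l.
rewrite opprD addrACA -scalerBr; set b := lambda *: _.
have bE : enorm b <= lambda * (2 - 2 * lambda ^+ size s).
  rewrite enormZ gtr0_norm // ler_pM2l //.
  apply: le_trans (ler_enormD _ _) _; rewrite enormN.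
  by have := word_center_inside s; have := word_center_inside t; rewrite -st; lra.
have := ler_enormB (c i - c j) (- b); rewrite opprK enormN.
by have := separated ij; rewrite exprS; lra.
Qed.

(** The same amplification as for coverings: nested packings have multiplicative
    numbers of points and radii. *)
Lemma pack_card : #|I|%:R * lambda ^+ n <= 1.
Proof.
have [I0|I0] := posnP #|I|; first by rewrite I0 mul0r.
have k0 : 0 < #|I|%:R * lambda ^+ n by rewrite mulr_gt0 ?ltr0n ?exprn_gt0.
rewrite -[leLHS]invrK invf_le1 ?invr_gt0 //.
apply: (@ge1_of_expr_lbound ((3 * D)^-1 ^+ n)).
- by rewrite exprn_gt0 // invr_gt0 mulr_gt0.
- by rewrite invr_ge0 ltW.
move=> L; rewrite !exprVn lef_pV2 ?posrE ?exprn_gt0 //; last by rewrite mulr_gt0.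
have lL : 0 < lambda ^+ L by rewrite exprn_gt0.
rewrite exprMn -exprM mulnC exprM -ler_pdivlMr ?exprn_gt0 // -expr_div_n.
rewrite -natrX -card_tuple.
apply: (@grid_pack_card _ (fun s : L.-tuple I => word_center s)) => //.
- by rewrite exprn_ile1 // ltW.
- move=> s; apply: le_trans (word_center_inside s) _.
  by rewrite size_tuple lerBlDr lerDl ltW.
- move=> s t st; have := @word_center_separated s t.
  by rewrite !size_tuple => /(_ erefl st).
Qed.

End CoverPack.

(** * The descent algorithm *)

Section Net.
Variables (R : realType) (d : nat).

Definition separated_in_half_ball (s : seq 'rV[R]_d) :=
  all (fun x => enorm x <= 2^-1) s &&
  pairwise (fun x y => 32^-1 <= enorm (x - y)) s.

(** After enlarging by [64 / 33], balls of radius [1 / 33] around the points of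
    [s] have disjoint interiors and lie in the unit ball. *)
Lemma separated_size s : separated_in_half_ball s -> (size s <= 33 ^ d)%N.
Proof.
move=> /andP[/allP ball_s /(pairwiseP 0) sep_s].
have h1 : 0 < 33^-1 :> R by rewrite invr_gt0 ltr0n.
have h2 : 33^-1 < 1 :> R by rewrite invf_lt1 ?ltr0n ?ltr1n.
have := @pack_card R d _ (fun i : 'I_(size s) => (64 / 33) *: s`_i) _ h1 h2.
rewrite card_ord exprVn ler_pdivrMr ?exprn_gt0 ?ltr0n // mul1r -natrX ler_nat.
have n0 : `|64 / 33| = 64 / 33 :> R by rewrite ger0_norm // divr_ge0.
apply=> [i|i j ij].
  rewrite enormZ n0.
  by have := ball_s s`_i (mem_nth _ (ltn_ord i)); lra.
rewrite -scalerBr enormZ n0; move: ij.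
wlog ij : i j / (i < j)%N => [h|_].
  rewrite neq_ltn => /orP[] ij; [|rewrite enormC]; apply: h => //;
  by rewrite neq_ltn ij ?orbT.
by have := sep_s i j (ltn_ord i) (ltn_ord j) ij; lra.
Qed.

(** A separated set of maximal size is a net. *)
Lemma exists_net : exists s : seq 'rV[R]_d, (size s <= 33 ^ d)%N /\
  forall y, enorm y <= 2^-1 -> exists2 p, p \in s & enorm (y - p) <= 32^-1.
Proof.
pose P k := `[< exists2 s, separated_in_half_ball s & size s = k >].
have P0 : exists k, P k by exists 0%N; apply/asboolP; exists [::].
have Pmax k : P k -> (k <= 33 ^ d)%N.
  by move=> /asboolP[s ss <-]; exact: separated_size.
case: (ex_maxnP P0 Pmax) => k /asboolP[s ss <-] smax.
exists s; split=> [|y yhalf]; first exact: separated_size.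
apply: contrapT => far; have : P (size s).+1.
  apply/asboolP; exists (y :: s) => //; case/andP: ss => bs ps.
  rewrite /separated_in_half_ball /= yhalf bs ps !andbT /=.
  apply/allP => p ps'; rewrite leNgt; apply/negP => py; apply: far.
  by exists p => //; exact: ltW.
by move=> /smax; rewrite ltnn.
Qed.

Definition net : seq 'rV[R]_d := sval (cid exists_net).

Lemma size_net : (size net <= 33 ^ d)%N.
Proof. by rewrite /net; case: cid => s []. Qed.

Lemma netP y : enorm y <= 2^-1 -> exists2 p, p \in net & enorm (y - p) <= 32^-1.
Proof. by rewrite /net; case: cid => s [] /= _; apply. Qed.

End Net.
Arguments net {R d}.

Section Descent.
Variables (R : realType) (d : nat).
Implicit Types (a b : 'rV[R]_d * R) (W : seq ('rV[R]_d * R)).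

Definition best a W := foldr (fun b c => if c.2 <= b.2 then c else b) a W.

Lemma best_mem a W : best a W \in a :: W.
Proof.
elim: W => [|b W IH] /=; first by rewrite mem_head.
case: ifP => _; last by rewrite !inE eqxx orbT.
by move: IH; rewrite !inE => /orP[->//|->]; rewrite !orbT.
Qed.

Lemma best_le a W b : b \in a :: W -> (best a W).2 <= b.2.
Proof.
elim: W b => [|c W IH] b; first by rewrite inE => /eqP ->.
have := best_mem a W => bm.
rewrite /= !inE; case: ifP => h.
  case/or3P => [/eqP ->|/eqP -> //|bW]; apply: IH; first exact: mem_head.
  by rewrite inE bW orbT.
move/negbT: h; rewrite -ltNge => h.
case/or3P => [/eqP ->|/eqP -> //|bW]; apply: (le_trans (ltW h)); apply: IH.
  exact: mem_head.
by rewrite inE bW orbT.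
Qed.

Let K := size (@net R d).

(** The first [j] rounds of [K] queries fill the first [j * K] entries of [W];
    the initial observation [a] stands apart. *)
Definition center a W j := best a (take (j * K) W).

Definition stalled a W j :=
  (center a W j).2 - 32^-1 < (center a W j.+1).2.

(** Only values are used: each round explores a net of the ball of radius
    [1 / 2] around the best known point, and after thirty-three rounds the
    center of the first stalled round is returned. *)
Definition descent_action (x0 : 'rV[R]_d) (V : seq ('rV[R]_d * R)) :
    action R d :=
  if V is a :: W then
    if (size W < 33 * K)%N then
      Query ((center a W (size W %/ K)).1 + net`_(size W %% K))
    else Return (center a W (find (stalled a W) (iota 0 33))).1
  else Query x0.

Definition observations (H : history R d) :=
  [seq (qh.1, response_fun qh.2 qh.1) | qh <- H].

Lemma same_germ_at (q : 'rV[R]_d) f g : same_germ q f g -> f q = g q.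
Proof.
move=> [nu nu0 fg]; apply: fg.
by rewrite inE /ecball /= subrr enorm0 ltW.
Qed.

Lemma observations_local H1 H2 : same_local_information H1 H2 ->
  observations H1 = observations H2.
Proof.
elim=> //= -[q1 h1] [q2 h2] l1 l2 [/= <- germ] _ IH; congr (_ :: _) => //.
by rewrite (same_germ_at germ).
Qed.

End Descent.

Definition descent (R : realType) : algorithm R :=
  @Algorithm R
    (fun d i H => descent_action (input_x0 i) (observations H))
    (fun d i => erefl)
    (fun d i H1 H2 H12 => congr1 _ (observations_local H12)).

Section Execution.
Variables (R : realType) (d : nat) (i : input R d) (f : 'rV[R]_d -> R).
Hypothesis fL : elipschitz_on 1 setT f.
Let K := size (@net R d).
Let x0 := input_x0 i.

Definition descent_trace (W : seq ('rV[R]_d * R)) :=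
  forall t, (t < size W)%N ->
    let q := (center (x0, f x0) W (t %/ K)).1 + net`_(t %% K) in
    nth (0, 0) W t = (q, f q).

Lemma center_rcons a (W : seq ('rV[R]_d * R)) b j : (j * K <= size W)%N ->
  center a (rcons W b) j = center a W j.
Proof. by move=> jW; rewrite /center -cats1 takel_cat. Qed.

Lemma descent_trace_rcons W : descent_trace W ->
  let q := (center (x0, f x0) W (size W %/ K)).1 + net`_(size W %% K) in
  descent_trace (rcons W (q, f q)).
Proof.
move=> tW q t; rewrite size_rcons ltnS => tsW; rewrite center_rcons; last first.
  exact: leq_trans (leq_trunc_div _ _) tsW.
rewrite nth_rcons; case: ltngtP tsW => // [tlt _|-> _]; last by [].
exact: tW.
Qed.

Lemma transcript_trace H : transcript (descent R) i f H ->
  H = [::] \/ exists2 W, observations H = (x0, f x0) :: W & descent_trace W.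
Proof.
elim=> [|H' q h tH IH]; first by left.
rewrite /= => act germ; right; have hq := same_germ_at germ.
rewrite /observations map_rcons -/(observations H') /= hq.
case: IH => [H0|[W HW tW]].
  by move: act; rewrite H0 /= => -[<-]; exists [::].
rewrite HW rcons_cons; exists (rcons W (q, f q)) => //.
move: act; rewrite HW /=; case: ifP => // _ [<-].
exact: descent_trace_rcons.
Qed.

Lemma lipschitz_locally : locally_lipschitz f.
Proof. by move=> x; exists 1, 1; split=> // y z _ _; exact: fL. Qed.

Lemma descent_transcript n : (n <= (33 * K).+1)%N ->
  exists2 H, transcript (descent R) i f H & size H = n.
Proof.
elim: n => [|n IH] nK; first by exists [::] => //; exact: transcript_nil.
have [H tH sH] := IH (ltnW nK).
suff [q act] : exists q, descent R d i H = Query q.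
  exists (rcons H (q, Response lipschitz_locally)); last by rewrite size_rcons sH.
  by apply: transcript_rcons => //; exists 1.
rewrite /=; case: (transcript_trace tH) => [->|[W HW _]]; first by exists x0.
rewrite HW /= ifT; first by eexists.
by move: (congr1 size HW) nK; rewrite size_map sH /= => ->; rewrite ltnS.
Qed.

(** Thirty-three rounds that each gain [1 / 32] would go below the infimum of
    [f]; a round that gains less certifies its center. *)
Lemma descent_return W : descent_trace W -> size W = (33 * K)%N ->
  has_lbound (range f) -> f x0 - inf (range f) <= 1 ->
  goldstein_stationary 2^-1 8^-1 f
    (center (x0, f x0) W
      (find (stalled (x0, f x0) W) (iota 0 33))).1.
Proof.
move=> tW sW lbf f0; set a := (x0, f x0).
have onW b : b \in a :: W -> b.2 = f b.1.
  rewrite inE => /orP[/eqP -> //|/(nthP (0, 0))[t tlt <-]].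
  by rewrite tW.
have onC j : (center a W j).2 = f (center a W j).1.
  apply: onW; have := best_mem a (take (j * K) W).
  by rewrite !inE => /orP[->//|/mem_take ->]; rewrite orbT.
have has_stall : has (stalled a W) (iota 0 33).
  apply: contraT; rewrite -all_predC => /allP nostall.
  have drop j : (j <= 33)%N -> (center a W j).2 <= f x0 - j%:R / 32.
    elim: j => [|j IH] j33; first by rewrite /center mul0n take0 mul0r subr0.
    have := nostall j; rewrite mem_iota /= add0n j33 => /(_ isT).
    by rewrite /stalled -leNgt -[j.+1%:R]natr1; have := IH (ltnW j33); lra.
  have := drop 33%N isT; rewrite onC.
  have : inf (range f) <= f (center a W 33).1.
    by apply: ge_inf => //; exists (center a W 33).1.
  by lra.
set j := find _ _; have j33 : (j < 33)%N.
  by rewrite /j -(size_iota 0 33) -has_find.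
have stall_j : stalled a W j.
  by have := nth_find 0%N has_stall; rewrite nth_iota.
apply: goldstein_stationary_small_decrease => // y yball.
have [|p pnet py] := @netP R d (y - (center a W j).1) _; first exact: yball.
pose k := index p net; have kK : (k < K)%N by rewrite index_mem.
have jkW : (j * K + k < j.+1 * K)%N by rewrite mulSn addnC ltn_add2r.
have jW : (j.+1 * K <= size W)%N by rewrite sW leq_mul2r j33 orbT.
have K0 : (0 < K)%N by exact: leq_ltn_trans kK.
have := tW (j * K + k)%N (leq_trans jkW jW) => /=.
rewrite divnMDl // divn_small // addn0 modnMDl modn_small // nth_index // -/a.
set q := _ + p => Wq.
have : (center a W j.+1).2 <= f q.
  rewrite -[f q]/(q, f q).2; apply: best_le; rewrite inE -Wq.
  apply/orP; right; rewrite -(@nth_take (j.+1 * K)) // mem_nth //.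
  by rewrite size_takel.
have : `|f q - f y| <= 32^-1.
  apply: le_trans (fL I I) _; rewrite mul1r enormC; apply: le_trans py.
  by rewrite /q opprD addrA.
move: stall_j; rewrite /stalled onC ler_norml; lra.
Qed.

End Execution.

Lemma T_det_upper_bound (R : realType) (d : nat) (x0 : 'rV[R]_d) :
  (T_det d 1 1 (2^-1) (8^-1) x0 <= (1 + 33 ^+ d.+1 : R)%:E)%E.
Proof.
apply: (@le_trans _ _ (ereal_sup
    [set query_count (descent R) (Input 1 1 x0 2^-1 8^-1) f
    | f in function_class 1 1 x0])).
  by apply: ereal_inf_lbound; exists (descent R).
apply: ge_ereal_sup => _ [f [fL lbf f0] <-].
set i := Input _ _ _ _ _.
have [H tH sH] := descent_transcript i fL (leqnn _).
apply: (@le_trans _ _ ((size H)%:R : R)%:E); last first.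
  rewrite lee_fin sH -natr1 addrC lerD2l -natrX ler_nat expnS leq_mul2l.
  by rewrite size_net orbT.
apply: ereal_inf_lbound; exists H => //; split=> //.
case: (transcript_trace tH) => [H0|[W HW tW]]; first by rewrite H0 in sH.
have sW : size W = (33 * size (@net R d))%N.
  by move: (congr1 size HW); rewrite size_map sH => -[].
exists (center (x0, f x0) W (find (stalled (x0, f x0) W) (iota 0 33))).1.
  rewrite (_ : descent R d i H = descent_action x0 (observations H)) //.
  by rewrite HW /descent_action sW ltnn.
exact: (descent_return fL tW sW lbf f0).
Qed.

(** * Directions avoiding few cones *)

Section Directions.
Variables (R : realType) (n : nat).
Implicit Types (v w x : 'rV[R]_n).

(** On the cone around a unit vector [e], a piece of the shell between the
    radii [a] and [b] lies in a ball centered at [k *: e]: the squared distance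
    to the center is a convex function of the radius, so that its bound is only
    needed at the two ends. *)
Lemma shell_cone_ball e x (a b k c r : R) : edot e e = 1 -> 0 <= k ->
  c * enorm x <= edot e x -> a <= enorm x -> enorm x <= b ->
  a ^+ 2 - 2 * k * c * a + k ^+ 2 <= r -> b ^+ 2 - 2 * k * c * b + k ^+ 2 <= r ->
  edot (x - k *: e) (x - k *: e) <= r.
Proof.
move=> e1 k0 cone ax xb ra rb; rewrite !edotE e1 (edotC x e) -sqr_enorm.
move: cone; set t := enorm x; set y := edot e x => cone.
have h1 : 2 * k * (c * t) <= 2 * k * y by rewrite ler_wpM2l ?mulr_ge0.
have [ab|ba] := ltP a b; last first.
  have ta : t = a by apply/eqP; rewrite eq_le ax (le_trans xb ba).
  by move: ra; rewrite -ta; lra.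
have h2 : 0 <= (t - a) * (b - t) by rewrite mulr_ge0 // subr_ge0.
suff : t ^+ 2 - 2 * k * c * t + k ^+ 2 <= r by lra.
have ba : 0 < b - a by rewrite subr_gt0.
rewrite -(ler_pM2r ba).
have : (a ^+ 2 - 2 * k * c * a + k ^+ 2) * (b - t) <= r * (b - t).
  by rewrite ler_wpM2r // subr_ge0.
have : (b ^+ 2 - 2 * k * c * b + k ^+ 2) * (t - a) <= r * (t - a).
  by rewrite ler_wpM2r // subr_ge0.
have : 0 <= (t - a) * (b - t) * (b - a) by rewrite mulr_ge0 // ltW.
by lra.
Qed.

(** Otherwise the cones around the vectors of [s] cover the space, and the unit
    ball is covered by one small central ball and two balls for each cone. *)
Lemma exists_direction (s : seq 'rV[R]_n) :
  (2 * size s).+1%:R < (7 / 2) ^+ n :> R ->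
  exists2 w, edot w w = 1 &
    forall v, v \in s -> edot v w <= 29 / 30 * enorm v.
Proof.
move=> small; apply: contrapT => none.
have cones x : x != 0 -> exists2 k : 'I_(size s), s`_k != 0 &
    29 / 30 * enorm s`_k * enorm x <= edot s`_k x.
  move=> x0; have nx : 0 < enorm x by rewrite enorm_gt0.
  apply: contrapT => nok; apply: none; exists ((enorm x)^-1 *: x).
    by rewrite edotZl edotZr -sqr_enorm; field; rewrite gt_eqF.
  move=> v vs; rewrite edotZr mulrC ler_pdivrMr //.
  rewrite leNgt; apply/negP => h; apply: nok.
  have vk : (index v s < size s)%N by rewrite index_mem.
  exists (Ordinal vk); rewrite /= nth_index ?(ltW h) //.
  by apply: contraTneq h => ->; rewrite enorm0 edot0l mulr0 mul0r ltxx.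
(* A ball of radius [2 / 7] centered on the axis of a cone contains its shell
   between the radii [2 / 3] and [1], and another one its shell between the
   radii [2 / 7] and [2 / 3]. *)
pose e k := (enorm s`_k)^-1 *: s`_k.
pose c (j : option ('I_(size s) * bool)) : 'rV[R]_n := match j with
  | None => 0
  | Some (k, true) => (43 / 50) *: e k
  | Some (k, false) => 2^-1 *: e k
  end.
have h27 : 0 < 2 / 7 :> R by lra.
suff /(cover_card h27) : forall x, enorm x <= 1 ->
    exists j, enorm (x - c j) <= 2 / 7.
  rewrite card_option card_prod card_ord card_bool mulnC -invf_div exprVn.
  by rewrite ler_pdivlMr ?exprn_gt0 ?divr_gt0 // mul1r leNgt small.
move=> x x1; have [x27|x27] := leP (enorm x) (2 / 7).
  by exists None; rewrite subr0.
have x0 : x != 0 by rewrite -enorm_gt0; apply: lt_trans x27.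
have [k k0] := cones x x0.
have nk : 0 < enorm s`_k by rewrite enorm_gt0.
have ek : edot (e k) (e k) = 1.
  by rewrite edotZl edotZr -sqr_enorm; field; rewrite gt_eqF.
rewrite -mulrA mulrCA -ler_pdivlMl // -edotZl -/(e k) => cone.
have [x23|x23] := leP (enorm x) (2 / 3).
  exists (Some (k, false)); rewrite ler_enorm; last exact: ltW.
  by apply: (shell_cone_ball ek _ cone (ltW x27) x23); lra.
exists (Some (k, true)); rewrite ler_enorm; last exact: ltW.
by apply: (shell_cone_ball ek _ cone (ltW x23) x1); lra.
Qed.

End Directions.

(** * The hard function *)

Section Gauge.
Variables (R : realType) (d : nat) (e u : 'rV[R]_d).
Hypotheses (e1 : edot e e = 1) (u1 : edot u u = 1) (eu : edot e u = 9 / 41).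
Implicit Types (v w x y z p : 'rV[R]_d).

Let enorm1 v : edot v v = 1 -> enorm v = 1.
Proof. by rewrite /enorm => ->; rewrite sqrtr1. Qed.

Definition orthogonal_part v := v - edot v u *: u.

Lemma orthogonal_partB v w :
  orthogonal_part (v - w) = orthogonal_part v - orthogonal_part w.
Proof. by rewrite /orthogonal_part edotBl scalerBl opprD addrACA opprD. Qed.

Lemma pythagoras v :
  edot v v = edot v u ^+ 2 + enorm (orthogonal_part v) ^+ 2.
Proof.
rewrite sqr_enorm /orthogonal_part !edotE u1 (edotC u v); ring.
Qed.

(** The support function of the unit vectors whose component on [u] is [9 / 41];
    the vector [e] is one of them.  Since (9, 40, 41) is a Pythagorean triple,
    it is 1-Lipschitz, while its slope [9 / 41] along [u] exceeds [1 / 8]. *)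
Definition gauge v := 9 / 41 * edot v u + 40 / 41 * enorm (orthogonal_part v).

Lemma gauge_le v : `|9 / 41 * `|edot v u| + 40 / 41 * enorm (orthogonal_part v)|
  <= enorm v.
Proof.
have n0 := enorm_ge0 (orthogonal_part v).
rewrite ger0_norm; last by rewrite addr_ge0 // mulr_ge0.
rewrite -(@ler_pXn2r _ 2) ?nnegrE ?enorm_ge0 //; last first.
  by rewrite addr_ge0 // mulr_ge0.
rewrite sqr_enorm pythagoras -(real_normK (num_real (edot v u))).
have := sqr_ge0 (40 / 41 * `|edot v u| - 9 / 41 * enorm (orthogonal_part v)).
by lra.
Qed.

Lemma gauge_lipschitz v w : `|gauge v - gauge w| <= enorm (v - w).
Proof.
have := gauge_le (v - w); rewrite ger0_norm; last first.
  by rewrite addr_ge0 // mulr_ge0 ?enorm_ge0.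
apply: le_trans; rewrite edotBl orthogonal_partB /gauge.
have := dist_enorm_le (orthogonal_part v) (orthogonal_part w).
set s := enorm _; set t := enorm _; set a := edot v u; set b := edot w u.
have -> : 9 / 41 * a + 40 / 41 * s - (9 / 41 * b + 40 / 41 * t) =
  9 / 41 * (a - b) + 40 / 41 * (s - t) by ring.
move=> st; apply: le_trans (ler_normD _ _) _.
rewrite (normrM (9 / 41)) (normrM (40 / 41)).
have [-> ->] : `|9 / 41| = 9 / 41 :> R /\ `|40 / 41| = 40 / 41 :> R.
  by split; rewrite ger0_norm // divr_ge0.
by lra.
Qed.

Lemma gauge0 : gauge 0 = 0.
Proof.
by rewrite /gauge /orthogonal_part edot0l scale0r subr0 enorm0 !mulr0 addr0.
Qed.

Lemma gauge_shift v t : gauge (v - t *: u) = gauge v - 9 / 41 * t.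
Proof.
rewrite /gauge orthogonal_partB [orthogonal_part (t *: u)]/orthogonal_part.
by rewrite edotBl edotZl u1 mulr1 subrr subr0; ring.
Qed.

(** Across [u] the gauge grows enough to compensate its decrease along [- u],
    except in a cone around [- u]: with [edot v u ^+ 2] at most [19 / 20] of
    [edot v v] and [b] the norm of the orthogonal part, the square of [40 * b]
    is more than [81 * edot v u ^+ 2]. *)
Lemma gauge_gt0 v : v != 0 -> 20 * edot v u ^+ 2 <= 19 * edot v v ->
  0 < gauge v.
Proof.
rewrite -enorm_gt0 => v0 cone; rewrite /gauge; set b := enorm _.
have b0 : 0 <= b by exact: enorm_ge0.
have vv : 0 < edot v v by rewrite -sqr_enorm exprn_gt0.
have := pythagoras v; rewrite -/b => vE; rewrite ltNge; apply/negP => neg.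
have : 0 <= (- (9 * edot v u) - 40 * b) * (- (9 * edot v u) + 40 * b).
  by rewrite mulr_ge0; lra.
by lra.
Qed.

(** As [edot _ e] is at most the gauge, this lies between [gauge - eta] and the
    gauge, and its germ at the origin is that of [edot _ e], which does not
    depend on [u]. *)
Definition spike (eta : R) v := Num.max (edot v e) (gauge v - eta).

Lemma norm_max_le (a b a' b' c : R) : `|a - a'| <= c -> `|b - b'| <= c ->
  `|Num.max a b - Num.max a' b'| <= c.
Proof. by rewrite !ler_norml /Num.max; do 2 case: ifP => /=; lra. Qed.

Lemma norm_min_le (a b a' b' c : R) : `|a - a'| <= c -> `|b - b'| <= c ->
  `|Num.min a b - Num.min a' b'| <= c.
Proof. by rewrite !ler_norml /Num.min; do 2 case: ifP => /=; lra. Qed.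

Lemma spike_lipschitz eta v w : `|spike eta v - spike eta w| <= enorm (v - w).
Proof.
apply: norm_max_le; first rewrite -edotBl.
  by apply: le_trans (norm_edot_le _ _) _; rewrite (enorm1 e1) mulr1.
by rewrite opprB addrA subrK gauge_lipschitz.
Qed.

Lemma spike_shift eta v t : spike eta (v - t *: u) = spike eta v - 9 / 41 * t.
Proof.
rewrite /spike gauge_shift edotBl edotZl (edotC u) eu.
by rewrite (mulrC t) addrAC addr_maxl.
Qed.

Lemma spike_germ eta v : enorm v <= eta / 2 -> spike eta v = edot v e.
Proof.
move=> v2; rewrite /spike max_l //.
have := gauge_lipschitz v 0; rewrite gauge0 !subr0.
have := norm_edot_le v e; rewrite (enorm1 e1) mulr1 !ler_norml; lra.
Qed.

Variables (p0 : 'rV[R]_d) (ps : seq 'rV[R]_d) (eta : R).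

Definition spikes x :=
  foldr (fun p m => Num.min (spike eta (x - p)) m) (spike eta (x - p0)) ps.

(** The floor makes the function bounded below; it is far from the points, where
   the function vanishes. *)
Definition hard_function x := Num.max (spikes x) (-1).

Lemma spikes_lipschitz x y : `|spikes x - spikes y| <= enorm (x - y).
Proof.
have spL p : `|spike eta (x - p) - spike eta (y - p)| <= enorm (x - y).
  by apply: le_trans (spike_lipschitz _ _ _) _; rewrite opprB addrA subrK.
by rewrite /spikes; elim: ps => //= p s IH; exact: norm_min_le.
Qed.

Lemma hard_function_lipschitz : elipschitz_on 1 setT hard_function.
Proof.
move=> x y _ _; rewrite mul1r; apply: norm_max_le (spikes_lipschitz x y) _.
by rewrite subrr normr0 enorm_ge0.
Qed.

Lemma spikes_shift x t : spikes (x - t *: u) = spikes x - 9 / 41 * t.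
Proof.
have sh p : spike eta (x - t *: u - p) = spike eta (x - p) - 9 / 41 * t.
  by rewrite addrAC spike_shift.
by rewrite /spikes; elim: ps => //= p s ->; rewrite sh addr_minl.
Qed.

Lemma spikes_le x p : p \in p0 :: ps -> spikes x <= spike eta (x - p).
Proof.
rewrite /spikes; elim: ps p => [|q s IH] p; first by rewrite inE => /eqP ->.
rewrite /= ge_min inE => /orP[/eqP ->|]; first by rewrite IH ?mem_head ?orbT.
rewrite inE => /orP[/eqP ->|ps']; first by rewrite lexx.
by rewrite IH ?orbT // inE ps' orbT.
Qed.

Lemma le_spikes x b : (forall p, p \in p0 :: ps -> b <= spike eta (x - p)) ->
  b <= spikes x.
Proof.
rewrite /spikes; elim: ps => [|q s IH] h /=; first by rewrite h ?mem_head.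
rewrite le_min h ?IH ?inE ?eqxx ?orbT // => p.
by rewrite inE => /orP[] ps'; apply: h; rewrite !inE ps' ?orbT.
Qed.

Hypotheses (eta0 : 0 < eta) (eta1 : eta <= 1).
Hypothesis separated : forall p q, p \in p0 :: ps -> q \in p0 :: ps ->
  p != q -> 3 * eta <= gauge (p - q).

(** Around a point the spike of this point is small, while the other ones are
    still larger than [eta]. *)
Lemma hard_function_germ p : p \in p0 :: ps ->
  same_germ p (fun x => edot (x - p) e) hard_function.
Proof.
move=> pP; exists (eta / 2); first by rewrite divr_gt0.
move=> x; rewrite inE /ecball /= => xp.
have spx := spike_germ xp.
have : - enorm (x - p) <= edot (x - p) e <= enorm (x - p).
  rewrite -ler_norml; apply: le_trans (norm_edot_le _ _) _.
  by rewrite (enorm1 e1) mulr1.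
move=> /andP[xe1 xe2].
have spE : spikes x = edot (x - p) e.
  apply/eqP; rewrite eq_le -{1}spx spikes_le //=; apply: le_spikes => q qP.
  have [<-|pq] := eqVneq p q; first by rewrite spx.
  rewrite /spike le_max; apply/orP; right.
  have := separated pP qP pq; have := gauge_lipschitz (x - q) (p - q).
  by rewrite opprB addrA subrK ler_norml; lra.
rewrite /hard_function spE max_l //; apply: le_trans xe1; rewrite lerN2.
by apply: le_trans xp _; move: eta0 eta1; lra.
Qed.

Lemma spikes_eq0 p : p \in p0 :: ps -> spikes p = 0.
Proof.
move=> pP; apply/eqP; rewrite eq_le; apply/andP; split.
  have := spikes_le p pP; rewrite subrr spike_germ ?edot0l //.
  by rewrite enorm0 divr_ge0 // ltW.
apply: le_spikes => q qP; rewrite /spike le_max.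
have [<-|pq] := eqVneq p q; first by rewrite subrr edot0l lexx.
rewrite (_ : 0 <= gauge (p - q) - eta) ?orbT //.
by move: eta0 (separated pP qP pq); lra.
Qed.

Lemma hard_function_value p : p \in p0 :: ps -> hard_function p = 0.
Proof. by move=> pP; rewrite /hard_function spikes_eq0 // max_l // lerN10. Qed.

Lemma hard_function_class p : p \in p0 :: ps ->
  function_class 1 1 p hard_function.
Proof.
move=> pP; have lb : lbound (range hard_function) (-1).
  by move=> _ [x _ <-]; rewrite /hard_function le_max lexx orbT.
split; [exact: hard_function_lipschitz | by exists (-1) |].
rewrite hard_function_value // sub0r lerNl; apply: lb_le_inf => //.
by exists (hard_function p), p.
Qed.

(** Above its floor, the hard function decreases at rate [9 / 41] along [- u],
    so that a half-space at distance [9 / 41] from the origin holds all the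
    Clarke subgradients in the ball of radius [1 / 2]. *)
Lemma hard_function_not_stationary p : p \in p0 :: ps ->
  ~ goldstein_stationary 2^-1 8^-1 hard_function p.
Proof.
move=> pP; rewrite /goldstein_stationary; apply/negP; rewrite -ltNge.
apply: (@lt_le_trans _ _ (9 / 41)%:E); first by rewrite lte_fin; lra.
apply: le_ereal_inf_tmp => _ [g gP <-]; rewrite lee_fin.
suff : 9 / 41 <= edot g u.
  by move=> h; apply: le_trans h _; rewrite -[leRHS]mulr1 -(enorm1 u1) edot_le.
move: g gP; pose H := [set g | 9 / 41 <= edot g u].
apply: (@smallest_sub _ _ _ H).
  move=> x y k; rewrite !inE /H /= => xu yu.
  have -> : edot (conv k x y) u =
      k%:num * edot x u + (1 - k%:num) * edot y u by rewrite edotDl !edotZl.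
  have k0 : 0 <= k%:num := ge0 k; have k1 : k%:num <= 1 := le1 k.
  have : 0 <= k%:num * (edot x u - 9 / 41) by rewrite mulr_ge0 // subr_ge0.
  have : 0 <= (1 - k%:num) * (edot y u - 9 / 41).
    by rewrite mulr_ge0 // subr_ge0.
  by lra.
move=> g [y yp /(_ (- u))]; rewrite edotNr => gu.
suff /(clarke_derivative_le _) :
    quotient_bound hard_function y (- u) 4^-1 (- (9 / 41)).
  have h4 : 0 < 4^-1 :> R by rewrite invr_gt0.
  by move=> /(_ h4)/(le_trans gu); rewrite lee_fin /H /=; lra.
move=> z t zy t0 t4; rewrite scalerN.
have := spikes_lipschitz z y; have := spikes_lipschitz y p.
rewrite (spikes_eq0 pP) subr0; move: yp zy; rewrite /ecball /= !ler_norml.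
rewrite /hard_function spikes_shift => yp zy sy sz.
by rewrite !max_l; lra.
Qed.

End Gauge.

(** * The resisting oracle *)

Section HiddenDirection.
Variables (R : realType) (n : nat).

Lemma edot_rV1 (x y : 'rV[R]_1) : edot x y = x 0 0 * y 0 0.
Proof. exact: big_ord1. Qed.

Lemma edot_row_mx m (a c : 'rV[R]_m) (b f : 'rV[R]_n) :
  edot (row_mx a b) (row_mx c f) = edot a c + edot b f.
Proof.
rewrite /edot big_split_ord /=; congr (_ + _); apply: eq_bigr => i _.
  by rewrite !row_mxEl.
by rewrite !row_mxEr.
Qed.

Definition first_axis : 'rV[R]_(1 + n) := row_mx 1%:M 0.

Lemma edot_first_axis : edot first_axis first_axis = 1.
Proof.
by rewrite edot_row_mx edot0l addr0 edot_rV1 !mxE eqxx mulr1n mulr1.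
Qed.

(** The component of the hidden direction on the first axis is fixed, so that
    it is increasing along the germs shown to the algorithm; its other
    component is chosen to be far from the differences of the points. *)
Lemma exists_hidden_direction (P : seq 'rV[R]_(1 + n)) :
  (2 * (size P * size P)).+1%:R < (7 / 2) ^+ n :> R ->
  exists u, [/\ edot u u = 1, edot first_axis u = 9 / 41 &
    forall p q, p \in P -> q \in P -> p != q -> 0 < gauge u (p - q)].
Proof.
move=> small; pose V := [seq rsubmx (p - q) | p <- P, q <- P].
have [|w w1 Vw] := @exists_direction R n V; first by rewrite size_allpairs.
pose u : 'rV[R]_(1 + n) := row_mx (9 / 41)%:M ((40 / 41) *: w).
have u1 : edot u u = 1.
  by rewrite edot_row_mx edotZl edotZr w1 edot_rV1 !mxE eqxx mulr1n; lra.
exists u; split=> // [|p q pP qP pq].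
  by rewrite edot_row_mx edot0l addr0 edot_rV1 !mxE eqxx !mulr1n mul1r.
apply: gauge_gt0 => //; first by rewrite subr_eq0.
have := Vw _ (allpairs_f (fun p q => rsubmx (p - q)) pP qP).
have := Vw _ (allpairs_f (fun p q => rsubmx (p - q)) qP pP).
rewrite -[q - p]opprB linearN /= edotNl enormN.
rewrite -[p - q]hsubmxK row_mxKr /u !edot_row_mx edotZr.
set r := rsubmx _; set s := edot r w; set l := lsubmx _ => h1 h2.
rewrite !edot_rV1 [_%:M 0 0]mxE eqxx mulr1n -(sqr_enorm r).
set a : R := l 0 0.
have r0 := enorm_ge0 r.
have : 0 <= (29 / 30 * enorm r - s) * (29 / 30 * enorm r + s).
  by rewrite mulr_ge0; lra.
(* What remains is a positive definite quadratic form in [a] and [s], whose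
   cross term is that of the square below. *)
by have := sqr_ge0 (160 * a - 45 * s); have := sqr_ge0 a; have := sqr_ge0 s; lra.
Qed.

Lemma exists_common_lower_bound (s : seq R) : (forall x, x \in s -> 0 < x) ->
  exists eta, [/\ 0 < eta, eta <= 1 & forall x, x \in s -> 3 * eta <= x].
Proof.
elim: s => [|x s IH] h; first by exists 1; split.
have [|eta [e0 e1 es]] := IH; first by move=> y ys; rewrite h // inE ys orbT.
have x0 : 0 < x by rewrite h // mem_head.
exists (Num.min eta (x / 3)); split.
- by rewrite lt_min e0 divr_gt0.
- by rewrite ge_min e1.
- have m1 : Num.min eta (x / 3) <= eta by rewrite ge_min lexx.
  have m2 : Num.min eta (x / 3) <= x / 3 by rewrite ge_min lexx orbT.
  move=> y; rewrite inE => /orP[/eqP ->|/es]; lra.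
Qed.

(** The finitely many differences of points of [P] have a gauge bounded away
    from zero, which leaves room for the loss [eta]. *)
Lemma exists_hard_function (P : seq 'rV[R]_(1 + n)) :
  (2 * (size P * size P)).+1%:R < (7 / 2) ^+ n :> R ->
  exists f, forall p, p \in P ->
    [/\ function_class 1 1 p f,
        same_germ p (fun x => edot (x - p) first_axis) f &
        ~ goldstein_stationary 2^-1 8^-1 f p].
Proof.
case: P => [|p0 ps] small; first by exists (fun=> 0).
have [u [u1 eu gP]] := exists_hidden_direction small.
pose P := p0 :: ps.
pose G := [seq gauge u (pq.1 - pq.2) |
  pq <- [seq pq <- [seq (p, q) | p <- P, q <- P] | pq.1 != pq.2]].
have [|eta [e0 e1 eP]] := @exists_common_lower_bound G.
  move=> x /mapP[[p q]]; rewrite mem_filter => /andP[pq].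
  move=> /allpairsPdep[a [b [aP bP [pa qb]]]] ->; rewrite /= pa qb in pq *.
  exact: gP.
have sep p q : p \in P -> q \in P -> p != q -> 3 * eta <= gauge u (p - q).
  move=> pP qP pq; apply: eP; apply/mapP; exists (p, q) => //.
  by rewrite mem_filter pq; apply/allpairsPdep; exists p, q.
exists (hard_function first_axis u p0 ps eta) => p pP; split.
- exact: (hard_function_class edot_first_axis u1 e0 sep).
- exact: (hard_function_germ edot_first_axis u1 e0 e1 sep).
- exact: (hard_function_not_stationary edot_first_axis u1 eu e0 sep).
Qed.

End HiddenDirection.

Section Adversary.
Variables (R : realType) (d : nat) (A : algorithm R) (i : input R d).
Variable e : 'rV[R]_d.
Let x0 := input_x0 i.

Lemma linear_germ_lipschitz (q : 'rV[R]_d) :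
  locally_lipschitz (fun x => edot (x - q) e).
Proof.
move=> x; exists 1, (enorm e); split=> // y z _ _.
by rewrite -edotBl opprB addrA subrK mulrC norm_edot_le.
Qed.

Definition resisting_response q := Response (linear_germ_lipschitz q).

(** The run of the algorithm against the oracle that always answers a zero value
    and the gradient [e]; it stays constant once the algorithm stops querying. *)
Fixpoint resisting_run k : history R d :=
  if k is j.+1 then
    let H := resisting_run j in
    if A d i H is Query q then rcons H (q, resisting_response q) else H
  else [::].

Definition queries (H : history R d) := map fst H.

Lemma size_resisting_run k : (size (resisting_run k) <= k)%N.
Proof.
elim: k => //= k IH; case: (A d i _) => [q|z|]; rewrite ?size_rcons //.
  exact: leqW.
exact: leqW.
Qed.

Lemma resisting_run_full k q :
  A d i (resisting_run k) = Query q -> size (resisting_run k) = k.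
Proof.
elim: k q => //= k IH q; case E: (A d i (resisting_run k)) => [q'|z|].
- by rewrite size_rcons (IH _ E).
- by rewrite E.
- by rewrite E.
Qed.

Lemma initial_query_resisting_run k : (0 < k)%N ->
  x0 \in queries (resisting_run k).
Proof.
case: k => // k _; elim: k => [|k IH].
  by rewrite /= first_query /queries /= mem_head.
move: IH; set j := k.+1; rewrite /=; case: (A d i (resisting_run j)) => // q.
by rewrite /queries map_rcons mem_rcons inE orbC => ->.
Qed.

Lemma transcript_resisting_run k f :
  (forall q, q \in queries (resisting_run k) ->
     same_germ q (fun x => edot (x - q) e) f) ->
  transcript A i f (resisting_run k).
Proof.
elim: k => [|k IH] /=; first by move=> _; exact: transcript_nil.
case E: (A d i (resisting_run k)) => [q|z|] // germ.
apply: transcript_rcons => //.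
  apply: IH => p pH; apply: germ.
  by rewrite /queries map_rcons mem_rcons inE pH orbT.
by apply: germ; rewrite /queries map_rcons mem_rcons mem_head.
Qed.

Lemma transcript_size_stopped f (H1 H2 : history R d) :
  transcript A i f H1 -> (forall q, A d i H1 <> Query q) ->
  transcript A i f H2 -> (size H2 <= size H1)%N.
Proof.
move=> t1 stop t2; rewrite leqNgt; apply/negP => lt12.
have : transcript A i f (take (size H1).+1 H2) by exact: transcript_take.
have t0 : transcript A i f (take (size H1) H2) by exact: transcript_take.
have s0 : size (take (size H1) H2) = size H1 by rewrite size_takel // ltnW.
have : size (take (size H1).+1 H2) = (size H1).+1 by rewrite size_takel.
move=> /[swap] t3; case: t3 => // K q h tK AK _; rewrite size_rcons => -[sK].
have := transcript_same_local_information t1 tK (esym sK).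
by move=> /(next_action_local A i); rewrite AK; exact: stop.
Qed.

(** The hypothesis is used for the queries of a run of [N - 1] steps and its
    possible output: a hard function for these points is compatible with the
    run, whose output is not stationary. *)
Lemma query_count_lower_bound (N : nat) : (1 < N)%N ->
  input_delta i = 2^-1 -> input_eps i = 8^-1 ->
  (forall P : seq 'rV[R]_d, (size P <= N)%N ->
     exists f, forall p, p \in P ->
       [/\ function_class 1 1 p f, same_germ p (fun x => edot (x - p) e) f &
           ~ goldstein_stationary 2^-1 8^-1 f p]) ->
  exists2 f, function_class 1 1 x0 f & ((N%:R : R)%:E <= query_count A i f)%E.
Proof.
case: N => // N N0 di ei hard; pose H := resisting_run N.
pose z := if A d i H is Return z then z else x0.
have [|f fP] := hard (z :: queries H).
  by rewrite /= ltnS size_map size_resisting_run.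
have germ q : q \in queries H -> same_germ q (fun x => edot (x - q) e) f.
  by move=> qH; have [|] := fP q; rewrite // inE qH orbT.
have tH : transcript A i f H by exact: transcript_resisting_run.
exists f.
  have [|//] := fP x0; rewrite inE /queries initial_query_resisting_run ?orbT //.
apply: le_ereal_inf_tmp => _ [H' [tH' [z' ret st]] <-].
rewrite lee_fin ler_nat ltnNge; apply/negP => H'N.
have HH' : (size H <= size H')%N.
  by apply: (transcript_size_stopped tH' _ tH) => q; rewrite ret.
have same : size H = size H' -> A d i H = Return z'.
  move=> ss; have := transcript_same_local_information tH tH' ss.
  by move=> /(next_action_local A i) ->.
case act : (A d i H) => [q|y|].
- have sH := resisting_run_full act; have := same _.
  rewrite act => /(_ _)/[!sH] h; have : Query q = Return z'; last by [].
  by apply: h; apply/eqP; rewrite eqn_leq -{1}sH HH'.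
- have H'H : (size H' <= size H)%N.
    by apply: (transcript_size_stopped tH _ tH') => q; rewrite act.
  have := same _; rewrite act => h; have [] : Return y = Return z'.
    by apply: h; apply/eqP; rewrite eqn_leq HH'.
  move=> yz'; have [|_ _] := fP z'; last by rewrite -di -ei.
  by rewrite inE /z act yz' eqxx.
- have H'H : (size H' <= size H)%N.
    by apply: (transcript_size_stopped tH _ tH') => q; rewrite act.
  by have := same _; rewrite act => h; have : Diverge = Return z' by
    apply: h; apply/eqP; rewrite eqn_leq HH'.
Qed.

End Adversary.

(** The number of pairs of points, hence of cones to avoid, is quadratic in [N],
    which is why the square of [N] is compared with the power. *)
Lemma T_det_lower_bound (R : realType) (n N : nat) (x0 : 'rV[R]_n.+1) :
  (1 < N)%N -> (2 * (N * N)).+1%:R < (7 / 2) ^+ n :> R ->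
  ((N%:R : R)%:E <= T_det n.+1 1 1 (2^-1) (8^-1) x0)%E.
Proof.
move=> N1 small; apply: le_ereal_inf_tmp => _ [A _ <-].
have [||P PN|f fc fN] := @query_count_lower_bound R n.+1 A
  (Input 1 1 x0 2^-1 8^-1) (@first_axis R n) N N1 => //.
  apply: exists_hard_function; apply: le_lt_trans small.
  by rewrite ler_nat ltnS leq_mul2l /= leq_mul.
by apply: le_trans fN _; apply: ereal_sup_ubound; exists f.
Qed.

(** * Exponential bounds and the absence of a polynomial bound *)

Section Consequences.
Variable R : realType.

Lemma T_det_floor_bound (d : nat) (x0 : 'rV[R]_d) : (4 <= d)%N ->
  (((Num.floor ((7 / 2 : R) `^ ((d%:R - 2) / 2)))%:~R : R)%:E
     <= T_det d 1 1 (2^-1) (8^-1) x0)%E.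
Proof.
case: d x0 => [//|[//|n]] x0 n2; set x := powR _ _.
have xx : x ^+ 2 = (7 / 2) ^+ n.
  rewrite /x -powR_mulrn ?powR_ge0 // -powRrM divfK // -powR_mulrn ?divr_ge0 //.
  by rewrite -(addn2 n) natrD addrK.
have x_ge : 7 / 2 <= x.
  have d4 : 4 <= n.+2%:R :> R by rewrite ler_nat.
  by rewrite -[leLHS]powRr1 ?divr_ge0 //; apply: ler_powR; lra.
have [x0' xt] : 0 <= x /\ (Num.floor x)%:~R = (Num.trunc x)%:R :> R.
  have x_ge0 : 0 <= x by exact: powR_ge0.
  split=> //; rewrite truncn_floor x_ge0 natr_absz ger0_norm //.
  by rewrite floor_ge0.
rewrite xt; apply: T_det_lower_bound; first by rewrite truncn_ge_nat //; lra.
have Nx : (Num.trunc x)%:R <= x by rewrite truncn_le.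
rewrite -natr1 natrM natrM exprS -xx expr2.
have : (Num.trunc x)%:R * (Num.trunc x)%:R <= x * x by rewrite ler_pM.
have : 7 / 2 * (7 / 2) <= x * x by rewrite ler_pM // divr_ge0.
lra.
Qed.

(** The power is at least the square of the exponential [y], and
    [y <= y ^+ 2 - 1] as soon as [y] is at least [5 / 2]; for smaller [y], the
    power is at least [7 / 2]. *)
Lemma expR_le_floor (d : nat) : (4 <= d)%N ->
  expR (ln (7 / 2 : R) / 8 * d%:R) <=
    (Num.floor ((7 / 2 : R) `^ ((d%:R - 2) / 2)))%:~R.
Proof.
move=> d4; have d4' : 4 <= d%:R :> R by rewrite ler_nat.
set x := powR _ _; set y := expR _.
have l0 : 0 < ln (7 / 2 : R) by rewrite ln_gt0 //; lra.
have x_ge : 7 / 2 <= x.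
  by rewrite -[leLHS]powRr1 ?divr_ge0 //; apply: ler_powR; lra.
have yyx : y * y <= x.
  rewrite -expRD /x /powR gt_eqF ?divr_gt0 // ler_expR.
  have : 0 <= ln (7 / 2 : R) * (d%:R - 4) by rewrite mulr_ge0 ?subr_ge0 // ltW.
  lra.
have y0 : 0 < y by exact: expR_gt0.
suff : y <= x - 1.
  move=> yx; apply: le_trans yx _; rewrite lerBlDr -[1]/(1%:~R) -rmorphD /=.
  by rewrite ltW // floorD1_gt.
have [y52|y52] := leP y (5 / 2); first by lra.
have : 0 <= (y - 5 / 2) * y by rewrite mulr_ge0 ?subr_ge0 // ltW.
lra.
Qed.

Lemma power_le_expR (d : nat) : (4 <= d)%N ->
  1 + 33 ^+ d.+1 <= expR (2 * ln 33 * d%:R) :> R.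
Proof.
move=> d4; rewrite expRM_natr mulrC expRM_natr lnK ?posrE // -exprM.
apply: (@le_trans _ _ (33 ^+ d.+2)); last first.
  by rewrite ler_eXn2l ?ltr1n // mulSn mul1n -addn2 leq_add2l ltnW // ltnW.
rewrite (exprS _ d.+1).
have : 1 <= 33 ^+ d.+1 :> R by rewrite exprn_ege1 // ler1n.
lra.
Qed.

Lemma monomial_sum_le_power (n : nat) (M : Type) (s : seq M) (a : M -> R)
    (e : M -> 'I_n -> nat) : exists C K, 0 <= C /\
  forall (v : 'I_n -> R) b, 1 <= b -> (forall i, 0 <= v i <= b) ->
    \sum_(m <- s) a m * \prod_(i < n) v i ^+ e m i <= C * b ^+ K.
Proof.
elim: s => [|m s [C [K [C0 CK]]]].
  by exists 0, 0%N; split=> // v b _ _; rewrite big_nil mul0r.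
exists (`|a m| + C), (\sum_(i < n) e m i + K)%N; split=> [|v b b1 vb].
  by rewrite addr_ge0.
have b0 : 0 <= b by exact: le_trans b1.
rewrite big_cons mulrDl; apply: lerD; last first.
  apply: le_trans (CK v b b1 vb) _; rewrite ler_wpM2l //.
  by rewrite ler_weXn2l // leq_addl.
apply: le_trans (ler_norm _) _; rewrite normrM ler_wpM2l //.
apply: (@le_trans _ _ (b ^+ \sum_(i < n) e m i)); last first.
  by rewrite ler_weXn2l // leq_addr.
rewrite expr_sum normr_prod; apply: ler_prod => i _.
have /andP[v0 v1] := vb i; rewrite normr_ge0 ger0_norm ?exprn_ge0 //.
by rewrite lerXn2r ?nnegrE.
Qed.

Lemma meval_le_power (n : nat) (p : mpoly.mpoly n R) : exists C K,
  0 <= C /\ forall (v : 'I_n -> R) b, 1 <= b -> (forall i, 0 <= v i <= b) ->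
    mpoly.meval v p <= C * b ^+ K.
Proof.
have [C [K [C0 CK]]] := monomial_sum_le_power (mpoly.msupp p)
  (fun m => mpoly.mcoeff m p) (@mpoly.fun_of_multinom n).
by exists C, K; split=> // v b b1 vb; rewrite mpoly.mevalE; exact: CK.
Qed.

(** The term of degree [K + 1] of the exponential series beats [C * x ^ K]. *)
Lemma exists_power_lt_expR (c C : R) (K : nat) : 0 < c -> 0 <= C ->
  exists2 d, (4 <= d)%N & C * (8 * d%:R) ^+ K < expR (c * d%:R).
Proof.
move=> c0 C0; pose B := C * 8 ^+ K * (K.+1)`!%:R / c ^+ K.+1.
have f0 : 0 < (K.+1)`!%:R :> R by rewrite ltr0n fact_gt0.
have cK : 0 < c ^+ K.+1 by rewrite exprn_gt0.
pose d := (Num.trunc B).+4; exists d => //.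
have dB : B < d%:R.
  by apply: lt_le_trans (truncnS_gt B) _; rewrite ler_nat !ltnS !leqW.
have d0 : 0 < d%:R :> R by rewrite ltr0n.
apply: lt_le_trans (_ : 1 + (c * d%:R) ^+ K.+1 / (K.+1)`!%:R <= _); last first.
  by apply: expR_ge1Dxn; rewrite mulr_ge0 // ltW.
apply: (@le_lt_trans _ _ ((c * d%:R) ^+ K.+1 / (K.+1)`!%:R)).
  rewrite ler_pdivlMr // exprMn exprMn (exprSr d%:R).
  have := ltW dB; rewrite /B ler_pdivrMr // => h.
  have dK : 0 <= d%:R ^+ K :> R by rewrite exprn_ge0 // ltW.
  by have := ler_wpM2r dK h; lra.
by rewrite ltrDr.
Qed.

Lemma no_polynomial_bound : ~ (exists p : mpoly.mpoly 3 R,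
  forall (d : nat) (delta eps : R) (x0 : 'rV[R]_d),
    (1 <= d)%N -> 0 < delta -> 0 < eps ->
    (T_det d 1 1 delta eps x0
       <= (mpoly.meval
             (tnth [tuple (d%:R : R); delta^-1; eps^-1]) p)%:E)%E).
Proof.
move=> [p bound]; have [C [K [C0 CK]]] := meval_le_power p.
have l0 : 0 < ln (7 / 2) / 8 :> R by rewrite divr_gt0 // ln_gt0 //; lra.
have [d d4 dC] := exists_power_lt_expR K l0 C0.
have h2 : 0 < 2^-1 :> R by rewrite invr_gt0.
have h8 : 0 < 8^-1 :> R by rewrite invr_gt0.
have d1 : (1 <= d)%N by exact: leq_trans d4.
have d1' : 1 <= d%:R :> R by rewrite ler1n.
have := le_trans (T_det_floor_bound 0 d4) (bound d 2^-1 8^-1 0 d1 h2 h8).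
rewrite lee_fin leNgt => /negP; apply.
apply: lt_le_trans (expR_le_floor d4); apply: le_lt_trans dC.
apply: CK; first by lra.
case=> -[|[|[|//]]] i3; rewrite /tnth /= ?invrK; lra.
Qed.

End Consequences.

Theorem corollary2p4 (R : realType) :
  [/\ (forall (d : nat) (x0 : 'rV[R]_d), (4 <= d)%N ->
         (((Num.floor ((7 / 2 : R) `^ ((d%:R - 2) / 2)))%:~R : R)%:E
            <= T_det d 1 1 (2^-1) (8^-1) x0)%E /\
         (T_det d 1 1 (2^-1) (8^-1) x0 <= (1 + 33 ^+ d.+1 : R)%:E)%E),
      (exists c C : R, [/\ 0 < c, 0 < C &
         forall (d : nat) (x0 : 'rV[R]_d), (4 <= d)%N ->
           ((expR (c * d%:R))%:E <= T_det d 1 1 (2^-1) (8^-1) x0)%E /\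
           (T_det d 1 1 (2^-1) (8^-1) x0 <= (expR (C * d%:R))%:E)%E]) &
      ~ (exists p : mpoly.mpoly 3 R,
           forall (d : nat) (delta eps : R) (x0 : 'rV[R]_d),
             (1 <= d)%N -> 0 < delta -> 0 < eps ->
             (T_det d 1 1 delta eps x0
                <= (mpoly.meval
                      (tnth [tuple (d%:R : R); delta^-1; eps^-1]) p)%:E)%E)].
Proof.
split; last exact: no_polynomial_bound.
  by move=> d x0 d4; split; [exact: T_det_floor_bound|exact: T_det_upper_bound].
exists (ln (7 / 2) / 8), (2 * ln 33); split.
- by rewrite divr_gt0 // ln_gt0 //; lra.
- by rewrite mulr_gt0 // ln_gt0 // ltr1n.
move=> d x0 d4; split.
  apply: le_trans (T_det_floor_bound x0 d4).
  by rewrite lee_fin; exact: expR_le_floor.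
apply: le_trans (T_det_upper_bound x0) _.
by rewrite lee_fin; exact: power_le_expR.
Qed.
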